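(* Let $q(x)=\prod_{i\in I}t_i(x_i)$, $I$ finite, be a target density on $\mathbb{R}^n$, where $\{x_i\}_{i\in I}$ forms a pairwise disjoint partition of the (components of the) vector $x\in\mathbb{R}^n$, and each $t_i$ is nonnegative and normalizable to a probability density in $x_i$ with finite second moment. If the Gaussian factor approximations $\tilde t_i(x)$ are initialized as functions of $x_i$ only, $\tilde t_i(x)=\tilde t_i(x_i)$, then the expectation propagation (EP) algorithm converges after one iteration (one sweep in which each factor is updated once), and the limit iterate $\{\tilde t_i\}$ satisfies the moment matching conditions: for every $i\in I$, the normalized distributions $\prod_{j}\tilde t_j$ and $t_i\prod_{j\ne i}\tilde t_j$ have the same mean and the same covariance.
   Context: EP algorithm: the target $\prod_{i\in I}t_i$ is approximated by $\prod_{i\in I}\tilde t_i$ with Gaussian factors $\tilde t_i$ (considered up to positive multiplicative constants; here each initial $\tilde t_i$ is a Gaussian in the variable $x_i$ with positive definite covariance). Starting from the initial $\{\tilde t_i\}$, repeatedly loop over $i\in I$, and for each $i$: (1) compute the Gaussian $\tilde q$ minimizing $D_{KL}\big(t_i\prod_{j\ne i}\tilde t_j,\tilde q\big)$ over Gaussians $\tilde q$ on $\mathbb{R}^n$ (products of factors being normalized to probability densities), i.e. the Gaussian with the same mean and covariance as the first argument; (2) set $\tilde t_i(x)=\tilde q(x)/\prod_{j\neq i}\tilde t_j(x)$, using the current values of the other factor approximations. Here $D_{KL}(q,\tilde q)=\int q\log(q/\tilde q)\,dx$. Convergence after one iteration means that after the first sweep all further updates leave the $\tilde t_i$ unchanged.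 *)

(* Defs.v *)
From HB Require Import structures.
From mathcomp Require Import all_boot all_order all_algebra.
From mathcomp Require Import all_classical all_reals all_analysis.

Set Implicit Arguments.
Unset Strict Implicit.
Unset Printing Implicit Defensive.

Import Order.TTheory GRing.Theory Num.Theory.

Local Open Scope classical_set_scope.
Local Open Scope ring_scope.

(* Points of R^n are n-tuples: the library equips them with the product
   (Borel) sigma-algebra.  Row vectors are used for means and for linear
   algebra only. *)
Definition euclid (R : realType) (n : nat) := n.-tuple (measurableTypeR R).

Section Lebesgue.
Context (R : realType).

Definition econs n (p : measurableTypeR R * euclid R n) : euclid R n.+1 :=
  [tuple of p.1 :: p.2].

Lemma measurable_econs n : measurable_fun setT (@econs n).
Proof. exact: measurable_cons. Qed.

Definition edecons n (x : euclid R n.+1) : measurableTypeR R * euclid R n :=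
  (thead x, [tuple of behead x]).

Lemma measurable_edecons n : measurable_fun setT (@edecons n).
Proof.
apply/measurable_fun_pairP; split; first exact: measurable_tnth.
exact: measurable_behead.
Qed.

Lemma edeconsK n : cancel (@edecons n) (@econs n).
Proof. by move=> x; rewrite /econs /edecons /= [RHS]tuple_eta. Qed.

Lemma econsK n : cancel (@econs n) (@edecons n).
Proof.
by move=> [a x]; rewrite /edecons /econs theadE; congr pair; exact: val_inj.
Qed.

Section step.
Variables (m1 : {sigma_finite_measure set (measurableTypeR R) -> \bar R}).
Variables (n : nat) (m : {sigma_finite_measure set (euclid R n) -> \bar R}).

Definition measure_econs : set (euclid R n.+1) -> \bar R :=
  pushforward (m1 \x m)%E (@econs n).

HB.instance Definition _ := Measure.copy measure_econs
  (measure_function_pushforward__canonical__measure_function_Measure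
     (m1 \x m)%E (@measurable_econs n)).

Lemma measure_econs_sigma_finite : sigma_finite setT measure_econs.
Proof.
have /sigma_finiteP[F [TF ndF Foo]] := sigma_finiteT m1.
have /sigma_finiteP[G [TG ndG Goo]] := sigma_finiteT m.
exists (fun k => @edecons n @^-1` (F k `*` G k)).
  rewrite -preimage_bigcup -[LHS](preimage_setT (@edecons n)).
  congr (_ @^-1` _); rewrite -setXTT TF TG predeqE => -[x y]; split.
    move=> [/= [i _ Fix] [j _ Gjy]]; exists (maxn i j) => //; split.
    - by move: x Fix; exact/subsetPset/ndF/leq_maxl.
    - by move: y Gjy; exact/subsetPset/ndG/leq_maxr.
  by move=> [i _ [/= ? ?]]; split; exists i.
move=> k; have [mF Fk] := Foo k; have [mG Gk] := Goo k; split.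
  rewrite -[X in measurable X]setTI; apply: measurable_edecons => //.
  exact: measurableX.
rewrite /measure_econs /pushforward -comp_preimage.
rewrite (_ : _ \o _ = id); last by rewrite funeqE => p /=; rewrite econsK.
by rewrite preimage_id product_measure1E// lte_mul_pinfty// ge0_fin_numE.
Qed.

HB.instance Definition _ := Measure_isSigmaFinite.Build _ _ _ measure_econs
  measure_econs_sigma_finite.

End step.

(* Lebesgue measure on R^n. *)
Fixpoint lebesgue_euclid (n : nat) :
    {sigma_finite_measure set (euclid R n) -> \bar R} :=
  if n is n'.+1 then measure_econs (@lebesgue_measure R) (lebesgue_euclid n')
  else \d_ ([tuple] : euclid R 0).

Lemma lebesgue_euclid_box n (A : 'I_n -> set (measurableTypeR R)) :
  (forall i, measurable (A i)) ->
  lebesgue_euclid n [set x | forall i, A i (tnth x i)] =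
  (\prod_(i < n) lebesgue_measure (A i))%E.
Proof.
elim: n A => [|n IHn] A mA.
  by rewrite big_ord0 /= diracE mem_set// => -[].
rewrite big_ord_recl /= /measure_econs /pushforward.
pose B := [set x : euclid R n | forall i, A (lift ord0 i) (tnth x i)].
have mB : measurable B.
  rewrite (_ : B = \bigcap_(i in [set: 'I_n])
      ((fun x : euclid R n => tnth x i) @^-1` A (lift ord0 i))).
    apply: fin_bigcap_measurable => // i _; rewrite -[X in measurable X]setTI.
    exact: measurable_tnth.
  by rewrite predeqE => x; split => [Bx i _|Bx i]; [exact: Bx|exact: (Bx i)].
rewrite (_ : econs (n:=n) @^-1` _ = A ord0 `*` B).
  by rewrite product_measure1E//; congr (_ * _)%E; exact: IHn.
rewrite predeqE => -[a x] /=; split => [H|[Aa Bx] i].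
  split; first exact: (H ord0).
  by move=> i; have := H (lift ord0 i); rewrite tnthS.
case: (unliftP ord0 i) => [j ->|-> //].
by rewrite tnthS; exact: Bx.
Qed.

End Lebesgue.

Section Densities.
Context (R : realType) (n : nat).
Implicit Types (f g p q : euclid R n -> R).

Local Notation mu := (@lebesgue_euclid R n).

Definition row_of (x : euclid R n) : 'rV[R]_n := \row_k tnth x k.

(* Equality up to a positive multiplicative constant. *)
Definition propto f g := exists2 c : R, 0 < c & forall x, f x = c * g x.

Definition sqnorm (x : euclid R n) : R := \sum_(k < n) tnth x k ^+ 2.

Definition normalizable_moment2 f :=
  [/\ measurable_fun setT f,
      forall x, 0 <= f x,
      (0 < \int[mu]_x (f x)%:E < +oo)%E &
      (\int[mu]_x (sqnorm x * f x)%:E < +oo)%E].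

Definition normalized f : euclid R n -> R :=
  fun x => f x / \int[mu]_y f y.

Definition mean p : 'rV[R]_n := \row_k \int[mu]_x (tnth x k * p x).

Definition covmx p : 'M[R]_n :=
  \matrix_(k, l)
    \int[mu]_x ((tnth x k - mean p 0 k) * (tnth x l - mean p 0 l) * p x).

Definition same_moments p q := mean p = mean q /\ covmx p = covmx q.

Definition posdef (S : 'M[R]_n) :=
  S^T = S /\ forall v : 'rV[R]_n, v != 0 -> 0 < (v *m S *m v^T) 0 0.

Definition gauss_pdf (m : 'rV[R]_n) (S : 'M[R]_n) : euclid R n -> R :=
  fun x => let d := row_of x - m in
  (Num.sqrt ((2 * pi) ^+ n * \det S))^-1 *
  expR (- (d *m invmx S *m d^T) 0 0 / 2).

Definition is_gaussian q :=
  exists m S, posdef S /\ forall x, q x = gauss_pdf m S x.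

(* Since ln 0 = 0 in the library, the integrand vanishes where p does. *)
Definition KL p q : \bar R := \int[mu]_x (p x * ln (p x / q x))%:E.

(* When p has infinite (negative) entropy, KL p q = +oo for every Gaussian q,
   so that minimizing selects nothing; the Gaussian with the moments of p is
   meant in that case.  In all other cases only minimality is required. *)
Definition gaussian_projection p q :=
  [/\ is_gaussian q,
      forall q', is_gaussian q' -> (KL p q <= KL p q')%E &
      KL p q = +oo%E -> same_moments p q].

End Densities.

Section ExpectationPropagation.
Context (R : realType) (n : nat) (I : finType).

(* A state lists the current factor approximations, each a function on the
   whole of R^n; f is the family of the factors of the target. *)
Definition ep_state := I -> euclid R n -> R.

Implicit Types (f T : ep_state) (st : nat -> ep_state).

Definition ep_global T : euclid R n -> R := fun x => \prod_(j : I) T j x.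

Definition ep_cavity T i : euclid R n -> R :=
  fun x => \prod_(j | j != i) T j x.

Definition ep_tilted f T i : euclid R n -> R :=
  fun x => f i x * ep_cavity T i x.

(* Factors are considered up to positive constants throughout. *)
Definition ep_update f i T T' :=
  normalizable_moment2 (ep_tilted f T i) /\
  exists2 q, gaussian_projection (normalized (ep_tilted f T i)) q &
    forall j, propto (T' j) (if j == i then fun x => q x / ep_cavity T i x
                             else T j).

(* [order r] is the order in which the r-th sweep visits I; update number k
   belongs to sweep k %/ #|I|. *)
Definition ep_run f (order : nat -> seq I) T0 st :=
  (forall i, propto (st 0%N i) (T0 i)) /\
  forall k i, onth (order (k %/ #|I|)%N) (k %% #|I|)%N = Some i ->
    ep_update f i (st k) (st k.+1).

Definition moment_matching f T i :=
  [/\ normalizable_moment2 (ep_global T),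
      normalizable_moment2 (ep_tilted f T i) &
      same_moments (normalized (ep_global T)) (normalized (ep_tilted f T i))].

End ExpectationPropagation.

Definition block (R : realType) (n : nat) (B : {set 'I_n}) (x : euclid R n) :
    euclid R #|B| :=
  [tuple tnth x (enum_val k) | k < #|B|].

(* Main.v *)
Require Import Defs.
From mathcomp Require Import all_boot all_order all_algebra.
From mathcomp Require Import all_classical all_reals all_analysis.
From mathcomp Require Import measurable_realfun ring lra.

Set Implicit Arguments.
Unset Strict Implicit.
Unset Printing Implicit Defensive.

Import Order.TTheory GRing.Theory Num.Theory.
Import numFieldNormedType.Exports.

Local Open Scope classical_set_scope.
Local Open Scope ring_scope.

(** A Gaussian density [q] enters the relative entropy from [p] to [q] only
    through the expectation under [p] of [ln q], a quadratic function, hence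
    only through the first two moments of [p].  One may therefore replace
    [p] by the Gaussian [g] with the same mean and covariance; Gibbs' inequality for [g]
    shows that the minimizer is unique and equal to [g] as long as relative
    entropies are finite, and when they are not the projection has the moments
    of [g] by definition ([gaussian_projectionP]).  The covariance of a density
    is positive definite because hyperplanes are null ([posdef_covmx]), so that
    [g] makes sense; and [gauss_pdf m S] has mean [m] and covariance [S] because
    it is the law of an affine image of a standard normal vector ([gauss_law],
    [gauss_moments]).

    Suppose now that every approximation is a Gaussian in the variables of its
    own block.  The tilted distribution of block [i] is the product of the
    exact factor of that block and of a cavity that involves only the other
    coordinates.  By Tonelli and Fubini its first two moments stay the same
    when the exact factor is traded for the Gaussian with the same moments
    ([same_moments_block_subst]); after that trade it is a product of Gaussians
    over the blocks, that is, a Gaussian with block-diagonal covariance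
    ([propto_block_gaussian]).  So the projection is this product, and dividing
    it by the cavity leaves the Gaussian of block [i] with the moments of the
    exact factor, whatever the other approximations are ([ep_updateP]).

    Hence an update of a block sets its factor, up to a constant, to one that
    depends on nothing else in the state.  One sweep visits every block, later
    updates change nothing, and at the limit the tilted and the global
    distributions have the same moments ([moment_matching_target]). *)

(** * Lebesgue measure on R^n *)

Section LebesgueEuclid.
Context {R : realType}.
Local Notation mu := (@lebesgue_euclid R).
Local Notation lam := (@lebesgue_measure R).

Definition box n (A : 'I_n -> set (measurableTypeR R)) : set (euclid R n) :=
  [set x | forall i, A i (tnth x i)].

Lemma measurable_box n (A : 'I_n -> set (measurableTypeR R)) :
  (forall i, measurable (A i)) -> measurable (box A).
Proof.
move=> mA; rewrite (_ : box A = \bigcap_(i in [set: 'I_n])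
    ((fun x : euclid R n => tnth x i) @^-1` A i)).
  apply: fin_bigcap_measurable => // i _; rewrite -[X in measurable X]setTI.
  exact: measurable_tnth.
by rewrite predeqE => x; split => [Bx i _|Bx i]; [exact: Bx|exact: (Bx i)].
Qed.

Lemma lebesgue_box n (A : 'I_n -> set (measurableTypeR R)) :
  (forall i, measurable (A i)) -> mu n (box A) = (\prod_(i < n) lam (A i))%E.
Proof. exact: lebesgue_euclid_box. Qed.

(** Boxes are closed under intersection, generate the sigma-algebra, and the
    cubes with centre [0] exhaust the space with finite measure. *)
Lemma lebesgue_euclid_unique n (m : {measure set (euclid R n) -> \bar R}) :
  (forall A : 'I_n -> set (measurableTypeR R), (forall i, measurable (A i)) ->
     m (box A) = (\prod_(i < n) lam (A i))%E) ->
  forall S, measurable S -> mu n S = m S.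
Proof.
move=> mE S mS.
pose G := [set X | exists2 A : 'I_n -> set (measurableTypeR R),
  (forall i, measurable (A i)) & X = box A].
pose g (k : nat) : set (euclid R n) := box (fun _ => `[- k%:R, k%:R]%classic).
apply: (measure_unique G g) => //.
- apply/seteqP; split; last first.
    apply: smallest_sub; first exact: sigma_algebra_measurable.
    by move=> _ [A mA ->]; exact: measurable_box.
  apply: smallest_sub; first exact: smallest_sigma_algebra.
  rewrite -bigcup_seq; apply: bigcup_sub => i _ _ [C mC <-].
  apply: sub_sigma_algebra.
  exists (fun j => if j == i then C else setT); first by move=> j; case: eqP.
  rewrite setTI; apply/seteqP; split => x /=.
    by move=> Cx j; case: eqP => [->|].
  by move=> /(_ i); rewrite eqxx.
- move=> _ _ [A mA ->] [C mC ->]; exists (fun i => A i `&` C i).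
    by move=> i; exact: measurableI.
  apply/seteqP; split => x /=; first by move=> [Ax Cx] i; split.
  by move=> AC_; split => i; case: (AC_ i).
- by move=> k; exists (fun _ => `[- k%:R, k%:R]%classic).
- apply/seteqP; split => // x _.
  pose s := \sum_(i < n) `|tnth x i|.
  exists (Num.truncn s).+1 => // i; rewrite /= in_itv/= -ler_norml.
  apply: le_trans (ltW (truncnS_gt s)).
  by rewrite /s (bigD1 i)//= lerDl sumr_ge0.
- move=> _ [A mA ->]; rewrite mE//; exact: lebesgue_box.
- move=> k; rewrite [X in (X < _)%E](lebesgue_box (fun _ => _))//.
  set r := lam _; have [r0 rfin] : (0 <= r /\ r < +oo)%E.
    rewrite /r lebesgue_measure_itv/=; case: ifPn => _;
      by rewrite ?ltry ?lee_fin ?opprK ?addr_ge0 ?ler0n.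
  suff /andP[] : (0 <= \prod_(i < n) r < +oo)%E by [].
  elim/big_ind : _ => [|x y /andP[x0 xy] /andP[y0 yy]|i _].
  - by rewrite lee01 ltry.
  - by rewrite mule_ge0//= lte_mul_pinfty// ge0_fin_numE.
  - by rewrite r0 rfin.
Qed.

Lemma integral_econs n (F : euclid R n.+1 -> \bar R) :
  measurable_fun setT F -> (forall x, 0 <= F x)%E ->
  (\int[mu n.+1]_x F x =
   \int[lam]_a \int[mu n]_x F (econs (a, x)))%E.
Proof.
move=> mF F0; rewrite [LHS]/= /measure_econs ge0_integral_pushforward//=.
- rewrite preimage_setT (@fubini_tonelli1 _ _ _ _ _ _ _ (F \o @econs R n))//.
  - by apply: measurableT_comp => //; exact: measurable_econs.
  - by move=> x; exact: F0.
- exact: measurable_econs.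
Qed.

Lemma measurable_tnth_comp d (T : measurableType d) n (f : T -> euclid R n) :
  measurable_fun setT f ->
  forall k, measurable_fun setT (fun x => tnth (f x) k : R).
Proof.
move=> mf k; apply: (@measurableT_comp _ _ _ _ _ _ (fun x : euclid R n => tnth x k)) => //.
exact: measurable_tnth.
Qed.

Lemma measurable_block n (B : {set 'I_n}) :
  measurable_fun setT (block B : euclid R n -> euclid R #|B|).
Proof.
apply/measurable_fun_tnthP => k.
rewrite (_ : _ \o _ = (fun x : euclid R n => tnth x (enum_val k))).
  exact: measurable_tnth.
by apply/funext => x /=; rewrite /block tnth_mktuple.
Qed.

End LebesgueEuclid.

(** * Splitting the coordinates into a block and its complement *)

Section Split.
Context {R : realType} {n : nat} (B : {set 'I_n}).
Local Notation mu := (@lebesgue_euclid R).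
Local Notation lam := (@lebesgue_measure R).

(** The inverse of taking the two blocks apart.  An index is always found in
    the enumeration where it is looked up, so the default value of [nth] does
    not occur. *)
Definition merge (p : euclid R #|B| * euclid R #|~: B|) : euclid R n :=
  [tuple if k \in B then nth 0 p.1 (index k (enum B))
         else nth 0 p.2 (index k (enum (~: B))) | k < n].

Definition off_block (w : euclid R n -> R) :=
  forall x y : euclid R n,
    (forall k, k \notin B -> tnth x k = tnth y k) -> w x = w y.

Lemma tnth_merge_in p (i : 'I_#|B|) : tnth (merge p) (enum_val i) = tnth p.1 i.
Proof.
rewrite tnth_mktuple enum_valP (tnth_nth 0); congr nth.
by rewrite /enum_val index_uniq ?enum_uniq// -cardE ltn_ord.
Qed.

Lemma tnth_merge_out p (i : 'I_#|~: B|) :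
  tnth (merge p) (enum_val i) = tnth p.2 i.
Proof.
have := enum_valP i; rewrite inE => /negbTE iB.
rewrite tnth_mktuple iB (tnth_nth 0); congr nth.
by rewrite /enum_val index_uniq ?enum_uniq// -cardE ltn_ord.
Qed.

Lemma block_merge p : block B (merge p) = p.1.
Proof. by apply: eq_from_tnth => i; rewrite tnth_mktuple tnth_merge_in. Qed.

Lemma measurable_merge : measurable_fun setT merge.
Proof.
have mnth d m (T : measurableType d) (f : T -> euclid R m) j : measurable_fun setT f ->
    measurable_fun setT (fun x => nth 0 (f x) j : R).
  move=> mf; have [jm|mj] := ltnP j m.
    rewrite (_ : (fun _ => _) = (fun x => tnth (f x) (Ordinal jm))).
      exact: measurable_tnth_comp.
    by apply/funext => x; rewrite (tnth_nth 0).
  rewrite (_ : (fun _ => _) = cst 0)//.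
  by apply/funext => x; rewrite nth_default// size_tuple.
apply/measurable_fun_tnthP => k.
rewrite (_ : _ \o _ = fun p : euclid R #|B| * euclid R #|~: B| =>
         if k \in B then nth 0 p.1 (index k (enum B))
         else nth 0 p.2 (index k (enum (~: B)))).
  by case: (k \in B); [exact: mnth measurable_fst|exact: mnth measurable_snd].
by apply/funext => p /=; rewrite tnth_mktuple.
Qed.

Let pushm := measure_function_pushforward__canonical__measure_function_Measure
  (mu #|B| \x mu #|~: B|)%E measurable_merge.

(** Both measures give the product of the lengths of its sides to a box. *)
Lemma lebesgue_euclid_merge S : measurable S -> mu n S = pushm S.
Proof.
apply: lebesgue_euclid_unique => A mA.
rewrite /pushm/= /pushforward.
rewrite (_ : merge @^-1` box A =
    box (fun i => A (enum_val i)) `*` box (fun i => A (enum_val i))); last first.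
  apply/seteqP; split => -[a b] /=.
    move=> Ax; split => i.
      by have := Ax (enum_val i); rewrite tnth_merge_in.
    by have := Ax (enum_val i); rewrite tnth_merge_out.
  move=> [Aa Ab] k; have [kB|kB] := boolP (k \in B).
    by have := Aa (enum_rank_in kB k); rewrite -(tnth_merge_in (a, b)) enum_rankK_in.
  have kC : k \in ~: B by rewrite inE.
  by have := Ab (enum_rank_in kC k); rewrite -(tnth_merge_out (a, b)) enum_rankK_in.
rewrite product_measure1E//; try exact: measurable_box.
rewrite !lebesgue_box// (bigID (mem B))/=; congr (_ * _)%E.
  by rewrite lebesgue_box// [RHS]big_enum_val.
rewrite -(big_enum_val (fun k => lam (A k))); apply: eq_bigl => k.
by rewrite inE.
Qed.

(** Integrating the block first, a block factor enters only through its
    integral. *)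
Lemma ge0_integral_block_subst (U V : euclid R #|B| -> R) (w : euclid R n -> R) :
  measurable_fun setT U -> measurable_fun setT V -> measurable_fun setT w ->
  (forall a, 0 <= U a) -> (forall a, 0 <= V a) -> (forall x, 0 <= w x) ->
  off_block w ->
  (\int[mu #|B|]_a (U a)%:E = \int[mu #|B|]_a (V a)%:E ->
   \int[mu n]_x (U (block B x) * w x)%:E =
   \int[mu n]_x (V (block B x) * w x)%:E)%E.
Proof.
move=> mU mV mw U0 V0 w0 ow UV.
pose W b := w (merge ([tuple 0 | _ < #|B|], b)).
have intE (X : euclid R #|B| -> R) : measurable_fun setT X ->
    (forall a, 0 <= X a) -> (\int[mu n]_x (X (block B x) * w x)%:E =
    \int[mu #|~: B|]_b ((W b)%:E * \int[mu #|B|]_a (X a)%:E))%E.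
  move=> mX X0.
  have mXw : measurable_fun setT (fun x : euclid R n => (X (block B x) * w x)%:E).
    apply/measurable_EFinP; apply: measurable_funM => //.
    by apply: measurableT_comp => //; exact: measurable_block.
  rewrite (eq_measure_integral pushm); last first.
    by move=> A mA _; exact: lebesgue_euclid_merge.
  rewrite ge0_integral_pushforward//=; last 2 first.
  - exact: measurable_merge.
  - by move=> x _; rewrite lee_fin mulr_ge0.
  rewrite preimage_setT fubini_tonelli2//=; last 2 first.
  - by apply: (measurableT_comp mXw); exact: measurable_merge.
  - by move=> x; rewrite lee_fin mulr_ge0.
  apply: eq_integral => b _; rewrite /fubini_G/= -ge0_integralZl//; last 3 first.
  - exact/measurable_EFinP.
  - by move=> a _; rewrite lee_fin.
  - by rewrite lee_fin; exact: w0.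
  apply: eq_integral => a _; rewrite block_merge/= mulrC EFinM; congr (_%:E * _)%E.
  by apply: ow => k kB; rewrite !tnth_mktuple (negbTE kB).
by rewrite !intE// UV.
Qed.

(** The signed version, with Fubini in place of Tonelli. *)
Lemma integral_block_subst (U V : euclid R #|B| -> R) (w : euclid R n -> R) :
  (mu #|B|).-integrable setT (EFin \o U) ->
  (mu #|B|).-integrable setT (EFin \o V) ->
  (mu n).-integrable setT (fun x => (U (block B x) * w x)%:E) ->
  (mu n).-integrable setT (fun x => (V (block B x) * w x)%:E) ->
  off_block w ->
  (\int[mu #|B|]_a (U a)%:E = \int[mu #|B|]_a (V a)%:E ->
   \int[mu n]_x (U (block B x) * w x)%:E =
   \int[mu n]_x (V (block B x) * w x)%:E)%E.
Proof.
move=> iU iV iUw iVw ow UV.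
pose W b := w (merge ([tuple 0 | _ < #|B|], b)).
have intE (X : euclid R #|B| -> R) : (mu #|B|).-integrable setT (EFin \o X) ->
    (mu n).-integrable setT (fun x => (X (block B x) * w x)%:E) ->
    (\int[mu n]_x (X (block B x) * w x)%:E =
    \int[mu #|~: B|]_b ((W b)%:E * \int[mu #|B|]_a (X a)%:E))%E.
  move=> iX iXw.
  have iXm : (mu #|B| \x mu #|~: B|)%E.-integrable setT
      ((fun x => (X (block B x) * w x)%:E) \o merge).
    have /integrableP[mXw Xwoo] := iXw.
    apply/integrableP; split.
      by apply: measurableT_comp => //; exact: measurable_merge.
    move: Xwoo; rewrite (eq_measure_integral pushm); last first.
      by move=> A mA _; exact: lebesgue_euclid_merge.
    rewrite ge0_integral_pushforward//=; last 2 first.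
    - exact: measurable_merge.
    - apply/measurable_EFinP; apply: measurableT_comp => //.
      exact/measurable_EFinP.
  rewrite (eq_measure_integral pushm); last first.
    by move=> A mA _; exact: lebesgue_euclid_merge.
  have /integrableP[mXw _] := iXw.
  rewrite (integral_pushforward measurable_merge mXw)// preimage_setT.
  rewrite -integral21_prod_meas1//.
  apply: eq_integral => b _; rewrite /fubini_G/= -integralZl//.
  apply: eq_integral => a _; rewrite block_merge/= mulrC EFinM; congr (_%:E * _)%E.
  by apply: ow => k kB; rewrite !tnth_mktuple (negbTE kB).
by rewrite !intE// UV.
Qed.

End Split.

(** * Linear changes of variables *)

Section ChangeOfVariables.
Context {R : realType}.
Local Notation mu := (@lebesgue_euclid R).
Local Notation lam := (@lebesgue_measure R).

(** Multiplied by [s], the push-forward of Lebesgue measure under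
    [x |-> a + s * x] gives their length to half-open intervals. *)
Lemma integral_affine (a s : R) (G : R -> \bar R) : 0 < s ->
  measurable_fun setT G -> (forall x, 0 <= G x)%E ->
  (\int[lam]_x G (a + s * x)%R = (s^-1)%:E * \int[lam]_x G x)%E.
Proof.
move=> s0 mG G0.
pose phi (x : measurableTypeR R) : measurableTypeR R := a + s * x.
have mphi : measurable_fun setT phi.
  by apply: measurable_funD => //; apply: measurable_funM.
pose push := measure_function_pushforward__canonical__measure_function_Measure
  lam mphi.
pose m := mscale (NngNum (ltW s0)) push.
have lamE A : measurable A -> lam A = m A.
  apply: lebesgue_measure_unique => _ [[b c]] _ <-.
  rewrite /m/= /mscale/= /pushforward.
  rewrite (_ : phi @^-1` _ = `](b - a) / s, (c - a) / s]%classic); last first.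
    apply/seteqP; split => x /=; rewrite !in_itv/= /phi ltr_pdivrMr// ler_pdivlMr//;
      rewrite ltrBlDl lerBrDl mulrC//.
  rewrite [RHS]/= !lebesgue_measure_itv/= !lte_fin ltr_pM2r ?invr_gt0// ltrD2r.
  case: ifPn => _; last by rewrite mule0.
  by rewrite -!EFinD -EFinM; congr EFin; field; rewrite gt_eqF.
rewrite [in RHS](eq_measure_integral m); last by move=> A mA _; exact: lamE.
rewrite ge0_integral_mscale//= ge0_integral_pushforward//=.
by rewrite preimage_setT muleA -EFinM mulVf ?gt_eqF// mul1e.
Qed.

Definition vec n (v : 'rV[R]_n) : euclid R n := [tuple v 0 k | k < n].

Lemma tnth_vec n (v : 'rV[R]_n) k : tnth (vec v) k = v 0 k.
Proof. by rewrite tnth_mktuple. Qed.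

Lemma row_of_vec n (v : 'rV[R]_n) : row_of (vec v) = v.
Proof. by apply/rowP => k; rewrite mxE tnth_vec. Qed.

Definition affine n (m : 'rV[R]_n) (L : 'M[R]_n) (z : euclid R n) : euclid R n :=
  vec (m + row_of z *m L).

Lemma tnth_affine n (m : 'rV[R]_n) (L : 'M[R]_n) z k :
  tnth (affine m L z) k = m 0 k + \sum_j tnth z j * L j k.
Proof.
by rewrite tnth_vec !mxE; congr (_ + _); apply: eq_bigr => j _; rewrite mxE.
Qed.

Lemma measurable_affine n (m : 'rV[R]_n) (L : 'M[R]_n) :
  measurable_fun setT (affine m L).
Proof.
apply/measurable_fun_tnthP => k.
rewrite (_ : _ \o _ = fun z : euclid R n => m 0 k + \sum_j tnth z j * L j k).
  apply: measurable_funD => //; apply: measurable_sum => j.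
  by apply: measurable_funM => //; exact: measurable_tnth.
by apply/funext => z; rewrite -tnth_affine.
Qed.

Lemma vec_row_mx n (c : R) (v : 'rV[R]_n) :
  vec (row_mx c%:M v : 'rV[R]_(1 + n)) = econs (c, vec v).
Proof.
apply: eq_from_tnth => k; rewrite tnth_vec.
case: (unliftP ord0 k) => [j ->|->].
  rewrite tnthS tnth_vec (_ : lift ord0 j = rshift 1 j) ?row_mxEr//.
  exact: val_inj.
rewrite [RHS]/= (_ : ord0 = lshift n (0 : 'I_1)) ?row_mxEl ?mxE ?eqxx//.
exact: val_inj.
Qed.

Lemma row_of_econs n (a : R) (x : euclid R n) :
  row_of (econs (a, x)) = row_mx a%:M (row_of x) :> 'rV[R]_(1 + n).
Proof.
rewrite -[RHS]row_of_vec vec_row_mx; congr (row_of (econs (_, _))).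
by apply: eq_from_tnth => k; rewrite tnth_vec mxE.
Qed.

(** The pivot and its Schur complement. *)
Lemma posdef_block n (s : R) (b : 'rV[R]_n) (C : 'M[R]_n) :
  posdef (block_mx s%:M b b^T C : 'M[R]_(1 + n)) ->
  0 < s /\ posdef (C - s^-1 *: (b^T *m b)).
Proof.
move=> [symS posS].
have s0 : 0 < s.
  have := posS (row_mx 1%:M 0).
  rewrite mul_row_block !mul1mx !mul0mx !addr0 tr_row_mx mul_row_col.
  rewrite !trmx0 mulmx0 addr0 tr_scalar_mx mulmx1 mxE eqxx mulr1n; apply.
  apply/eqP => /matrixP /(_ 0 (lshift n 0)).
  by rewrite row_mxEl !mxE eqxx => /eqP; rewrite oner_eq0.
have symC : C^T = C.
  move: symS; rewrite tr_block_mx trmxK => /(congr1 drsubmx).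
  by rewrite !block_mxKdr.
split => //; split.
  by rewrite linearB/= linearZ/= trmx_mul trmxK symC.
move=> w w0.
(* the first coordinate that minimizes the form for the given [w] *)
have := posS (row_mx (- s^-1 *: (w *m b^T)) w).
rewrite mul_row_block mul_mx_scalar scalerA mulrN divff ?gt_eqF// scaleN1r addNr.
rewrite tr_row_mx mul_row_col mul0mx add0r.
rewrite addrC -scalemxAl mulmxDl -scalemxAl !scaleNr.
rewrite mulmxBr mulmxBl -!scalemxAr -!scalemxAl mulmxA.
move=> H; apply: H; apply: contra_neq w0 => /(congr1 rsubmx).
by rewrite row_mxKr linear0.
Qed.

(** Cholesky factorization together with the change of variables that it
    induces: eliminating one coordinate at a time makes the map triangular, so
    that only one-dimensional affine substitutions are needed. *)
Lemma cholesky_substitution n (S : 'M[R]_n) : posdef S ->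
  exists L : 'M[R]_n, [/\ S = L^T *m L, 0 < \det L &
    forall (m : 'rV[R]_n) (F : euclid R n -> \bar R),
      measurable_fun setT F -> (forall x, 0 <= F x)%E ->
      (\int[mu n]_z F (affine m L z) = ((\det L)^-1)%:E * \int[mu n]_x F x)%E].
Proof.
elim: n S => [|n IHn] S posS.
  exists 1%:M; split; first by rewrite [LHS]flatmx0 [RHS]flatmx0.
    by rewrite det1.
  move=> m F mF F0; rewrite det1 invr1 mul1e; apply: eq_integral => z _.
  by congr F; apply: eq_from_tnth => -[].
pose s := S 0 0; pose b : 'rV[R]_n := @ursubmx R 1 n 1 n S.
pose C : 'M[R]_n := @drsubmx R 1 n 1 n S.
have SE : S = block_mx s%:M b b^T C :> 'M[R]_(1 + n).
  rewrite -[LHS](@submxK R 1 n 1 n); congr block_mx.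
    by rewrite [LHS]mx11_scalar !mxE; congr ((S _ _)%:M); exact: val_inj.
  by rewrite /b trmx_ursub; case: posS => ->.
have [s0 posC] : 0 < s /\ posdef (C - s^-1 *: (b^T *m b)).
  by apply: posdef_block; rewrite -SE.
have [L [LE L0 Lint]] := IHn _ posC.
have rs0 : 0 < Num.sqrt s by rewrite sqrtr_gt0.
have rs2 : Num.sqrt s * Num.sqrt s = s by rewrite -expr2 sqr_sqrtr// ltW.
pose M : 'M[R]_(1 + n) := block_mx (Num.sqrt s)%:M ((Num.sqrt s)^-1 *: b) 0 L.
have detE : \det M = Num.sqrt s * \det L by rewrite det_ublock det_scalar1.
have ME : M^T *m M = block_mx s%:M b b^T C.
  rewrite tr_block_mx mulmx_block; congr block_mx.
  - by rewrite trmx0 mul0mx addr0 tr_scalar_mx -scalar_mxM rs2.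
  - rewrite trmx0 mul0mx addr0 tr_scalar_mx mul_scalar_mx scalerA divff ?gt_eqF//.
    by rewrite scale1r.
  - rewrite mulmx0 addr0 linearZ/= mul_mx_scalar scalerA divff ?gt_eqF//.
    by rewrite scale1r.
  - rewrite -LE [X in X + _]linearZ/= linearZ/= -scalemxAl scalerA -invfM rs2.
    by rewrite addrC subrK.
exists M; split; [exact: etrans SE (esym ME)|by rewrite detE mulr_gt0|].
move=> m F mF F0; rewrite detE.
pose m0 := m 0 0; pose m' : 'rV[R]_n := @rsubmx R 1 1 n m.
have affE a z : affine m M (econs (a, z)) = econs (m0 + Num.sqrt s * a,
      affine (m' + (a / Num.sqrt s) *: b) L z).
  rewrite /affine -vec_row_mx; congr vec.
  have rowM : row_mx a%:M (row_of z) *m M =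
      row_mx (Num.sqrt s * a)%:M ((a / Num.sqrt s) *: b + row_of z *m L).
    rewrite /M mul_row_block mulmx0 addr0 -scalar_mxM mul_scalar_mx.
    by rewrite scalerA (mulrC a (Num.sqrt s)).
  have mE : m = row_mx m0%:M m' :> 'rV[R]_(1 + n).
    rewrite -[LHS](@hsubmxK R 1 1 n); congr row_mx.
    by rewrite [LHS]mx11_scalar !mxE; congr ((m _ _)%:M); exact: val_inj.
  rewrite row_of_econs; transitivity (row_mx m0%:M m' + row_mx a%:M (row_of z) *m M).
    by rewrite -mE.
  by rewrite rowM add_row_mx -raddfD addrA.
have maff := @measurable_affine _ m M.
rewrite integral_econs//; last exact: measurableT_comp.
pose G a := (\int[mu n]_x F (econs (a, x)))%E.
have mFe : measurable_fun setT (F \o @econs R n).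
  by apply: measurableT_comp => //; exact: measurable_econs.
have mG : measurable_fun (setT : set (measurableTypeR R)) G.
  have F0e x : (0 <= (F \o @econs R n) x)%E by exact: F0.
  exact: (measurable_fun_fubini_tonelli_F (m2:=mu n) _ mFe F0e).
transitivity (\int[lam]_a (((\det L)^-1)%:E * G (m0 + Num.sqrt s * a)%R))%E.
  apply: eq_integral => a _; under eq_integral do rewrite affE.
  pose Fa x := F (econs (m0 + Num.sqrt s * a, x)).
  rewrite (Lint _ Fa)//; last by move=> x; exact: F0.
  exact: (measurableT_comp mFe (measurable_pair1 _)).
have G0 a : (0 <= G a)%E by exact: integral_ge0.
rewrite ge0_integralZl//; last 2 first.
- by apply: (measurableT_comp mG); apply: measurable_funD => //; exact: measurable_funM.
- by rewrite lee_fin invr_ge0 ltW.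
by rewrite integral_affine// muleA -EFinM -invfM mulrC integral_econs.
Qed.

End ChangeOfVariables.

(** * Null hyperplanes *)

Section Hyperplane.
Context {R : realType}.
Local Notation mu := (@lebesgue_euclid R).
Local Notation lam := (@lebesgue_measure R).

Definition hyperplane n (v : 'rV[R]_n) (c : R) : set (euclid R n) :=
  [set x | \sum_k v 0 k * tnth x k = c].

Lemma measurable_hyperplane n (v : 'rV[R]_n) c : measurable (hyperplane v c).
Proof.
rewrite -[X in measurable X]setTI.
have mf : measurable_fun setT (fun x : euclid R n => \sum_k v 0 k * tnth x k).
  apply: measurable_sum => k; apply: measurable_funM => //.
  exact: measurable_tnth.
exact: (mf measurableT [set c]).
Qed.

(** By induction on the dimension: either all sections over the first
    coordinate are null hyperplanes, or the set is a singleton times the whole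
    space. *)
Lemma lebesgue_hyperplane n (v : 'rV[R]_n) c : v != 0 ->
  mu n (hyperplane v c) = 0%E.
Proof.
elim: n v c => [v c|n IHn v c v0]; first by rewrite [v]thinmx0 eqxx.
rewrite [LHS]/= /measure_econs /pushforward.
pose v' := \row_k v 0 (lift ord0 k).
have inE a x : hyperplane v c (econs (a, x)) <->
    v 0 ord0 * a + \sum_k v' 0 k * tnth x k = c.
  rewrite /hyperplane/= big_ord_recl/=.
  rewrite (eq_bigr (fun k => v' 0 k * tnth x k))// => k _.
  by rewrite tnthS mxE.
have [v'0|v'0] := eqVneq v' 0.
  have v00 : v 0 ord0 != 0.
    apply: contra_neq v0 => v00; apply/rowP => k; rewrite mxE.
    case: (unliftP ord0 k) => [j ->|->//].
    by have /rowP/(_ j) := v'0; rewrite !mxE.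
  rewrite (_ : econs (n:=n) @^-1` _ = [set c / v 0 ord0] `*` setT).
    by rewrite product_measure1E// [X in (X * _)%E]lebesgue_measure_set1 mul0e.
  apply/seteqP; split => -[a x] /=; rewrite inE v'0.
    rewrite big1 ?addr0 => [<-|k _]; last by rewrite mxE mul0r.
    by split => //; rewrite mulrC mulKf.
  move=> [-> _]; rewrite big1 ?addr0 => [|k _]; last by rewrite mxE mul0r.
  by rewrite mulrC divfK.
rewrite /product_measure1 integral0_eq// => a _ /=.
rewrite -[RHS](IHn v' (c - v 0 ord0 * a) v'0); congr (mu n _).
apply/seteqP; split => x; rewrite /xsection/= in_setE/= inE.
  by move=> <-; rewrite addrAC subrr add0r.
by rewrite /hyperplane/= => ->; rewrite addrC subrK.
Qed.

End Hyperplane.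

(** * Moments of the standard normal law *)

Section StandardNormal.
Context {R : realType}.
Local Notation mu := (@lebesgue_euclid R).
Local Notation lam := (@lebesgue_measure R).
Local Notation phi := (normal_pdf (0 : R) 1).

Lemma normal_pdf0E (t x : R) : 0 < t ->
  normal_pdf 0 t x = (t * Num.sqrt (2 * pi))^-1 * expR (- (x ^+ 2) / (2 * t ^+ 2)).
Proof.
move=> t0; rewrite normal_pdfE ?gt_eqF// /normal_peak /normal_fun subr0.
congr (_^-1 * expR (_ / _)); last by rewrite mulr_natl.
have -> : t ^+ 2 * pi *+ 2 = t ^+ 2 * (2 * pi) by rewrite -mulr_natl; ring.
by rewrite sqrtrM ?sqr_ge0// sqrtr_sqr gtr0_norm.
Qed.

(** Since [x ^+ 2 / 4 <= expR (x ^+ 2 / 4)], the normal density of variance [2]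
    dominates, up to a constant factor. *)
Lemma integrable_sqr_normal :
  lam.-integrable setT (fun x => (x ^+ 2 * phi x)%:E).
Proof.
pose t : R := Num.sqrt 2.
have t0 : 0 < t by rewrite sqrtr_gt0.
have t2 : t ^+ 2 = 2 by rewrite sqr_sqrtr.
have ig : lam.-integrable setT (fun x => (4 * t)%:E * (normal_pdf 0 t x)%:E)%E.
  by apply: integrableZl => //; exact: integrable_normal_pdf.
apply: (le_integrable _ _ _ ig) => //.
- apply/measurable_EFinP; apply: measurable_funM; last exact: measurable_normal_pdf.
  exact: measurable_funX.
- move=> x _; rewrite -EFinM /= lee_fin.
  rewrite ger0_norm ?(mulr_ge0 (sqr_ge0 x)) ?normal_pdf_ge0//.
  rewrite ger0_norm ?(mulr_ge0 (mulr_ge0 _ (ltW t0))) ?normal_pdf_ge0//.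
  rewrite !normal_pdf0E// expr1n mulr1 mul1r t2.
  have -> : - x ^+ 2 / 2 = - (x ^+ 2 / (2 * 2)) + - (x ^+ 2 / (2 * 2)) by field.
  rewrite mulNr expRD (invfM t).
  set c := (Num.sqrt _)^-1; set e := expR _.
  have c0 : 0 <= c by rewrite invr_ge0.
  have xe : x ^+ 2 * e <= 4.
    rewrite /e expRN ler_pdivrMr ?expR_gt0//.
    by have := expR_ge1Dx (x ^+ 2 / (2 * 2)); lra.
  have -> : 4 * t * (t^-1 * c * e) = 4 * (c * e) by field; rewrite gt_eqF.
  have -> : x ^+ 2 * (c * (e * e)) = x ^+ 2 * e * (c * e) by ring.
  by rewrite ler_wpM2r// mulr_ge0// expR_ge0.
Qed.

(** Up to the factor [t], the normal density of standard deviation [t] is a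
    convex function of [t ^- 2]; it lies above its tangent at [t = 1], whose
    integral involves the second moment [v].  As the density integrates to [1]
    for every [t], this gives [1 - (t ^- 2 - 1) / 2 * v <= t], with equality at
    [t = 1]; comparing the slopes there gives [v = 1]. *)
Lemma integral_sqr_normal : (\int[lam]_x (x ^+ 2 * phi x)%:E = 1)%E.
Proof.
have iphi : lam.-integrable setT (fun x => (phi x)%:E).
  exact: integrable_normal_pdf.
have i2 := integrable_sqr_normal.
have /fineK := integrable_fin_num measurableT i2; set v := fine _ => vE.
rewrite -vE; congr EFin.
have v0 : 0 <= v.
  rewrite -lee_fin vE integral_ge0// => x _.
  by rewrite lee_fin (mulr_ge0 (sqr_ge0 x)) ?normal_pdf_ge0.
have H (t : R) : 0 < t -> 1 - (t ^- 2 - 1) / 2 * v <= t.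
  move=> t0; pose a := (t ^- 2 - 1) / 2.
  have it : lam.-integrable setT (fun x => (normal_pdf 0 t x)%:E).
    exact: integrable_normal_pdf.
  have : (\int[lam]_x ((phi x)%:E - a%:E * (x ^+ 2 * phi x)%:E) <=
      \int[lam]_x (t%:E * (normal_pdf 0 t x)%:E))%E.
    apply: le_integral => //.
    - by apply: integrableB => //; exact: integrableZl.
    - exact: integrableZl.
    move=> x _; rewrite -!EFinM -EFinB lee_fin !normal_pdf0E// expr1n mulr1 mul1r.
    have -> : - x ^+ 2 / (2 * t ^+ 2) = - (a * x ^+ 2) + - x ^+ 2 / 2.
      by rewrite /a; field; rewrite gt_eqF.
    rewrite expRD (invfM t).
    set c := (Num.sqrt _)^-1; set e := expR (- x ^+ 2 / 2).
    have c0 : 0 <= c by rewrite invr_ge0.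
    have -> : c * e - a * (x ^+ 2 * (c * e)) = (1 - a * x ^+ 2) * (c * e) by ring.
    have -> : t * (t^-1 * c * (expR (- (a * x ^+ 2)) * e)) =
        expR (- (a * x ^+ 2)) * (c * e) by field; rewrite gt_eqF.
    by rewrite ler_wpM2r ?mulr_ge0 ?expR_ge0// expR_ge1Dx.
  rewrite integralB//; last exact: integrableZl.
  by rewrite !integralZl// !integral_normal_pdf -vE mule1 -EFinM -EFinB lee_fin.
have {}H (t : R) : 0 < t -> (1 - t) * (2 * t ^+ 2 - (1 + t) * v) <= 0.
  move=> t0; have := H _ t0; rewrite -(ler_pM2r (_ : 0 < 2 * t ^+ 2)); last first.
    by rewrite mulr_gt0// exprn_gt0.
  have -> : (1 - (t ^- 2 - 1) / 2 * v) * (2 * t ^+ 2) =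
      2 * t ^+ 2 - (1 - t ^+ 2) * v by field; rewrite gt_eqF.
  rewrite -subr_ge0 -oppr_le0; apply: le_trans.
  by rewrite le_eqVlt; apply/orP; left; apply/eqP; ring.
apply/eqP; rewrite eq_le; apply/andP; split; rewrite leNgt; apply/negP => v1.
(* a failing [t] lies between [1] and [v], close to [1] *)
- pose d := (v - 1) / 4; have d0 : 0 < d by rewrite /d; lra.
  have := H (1 + d) ltac:(lra); have -> : v = 1 + 4 * d by rewrite /d; field.
  have -> : (1 - (1 + d)) * (2 * (1 + d) ^+ 2 - (1 + (1 + d)) * (1 + 4 * d)) =
    d ^+ 2 * (5 + 2 * d) by ring.
  by rewrite leNgt mulr_gt0 ?exprn_gt0//; lra.
- pose d := (1 - v) / 4; have d0 : 0 < d by rewrite /d; lra.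
  have d1 : d <= 1 / 4 by rewrite /d; lra.
  have := H (1 - d) ltac:(lra); have -> : v = 1 - 4 * d by rewrite /d; field.
  have -> : (1 - (1 - d)) * (2 * (1 - d) ^+ 2 - (1 + (1 - d)) * (1 - 4 * d)) =
    d ^+ 2 * (5 - 2 * d) by ring.
  by rewrite leNgt mulr_gt0 ?exprn_gt0//; lra.
Qed.

End StandardNormal.

(** * Quadratic functions and the moments of a density *)

Section Moments.
Context {R : realType} {n : nat}.
Implicit Types (p q F G : euclid R n -> R).
Local Notation mu := (@lebesgue_euclid R n).

(** The functions that the first two moments of a density integrate: mean and
    covariance entries, and the logarithms of Gaussian densities, are all of
    this kind. *)
Inductive quadratic : (euclid R n -> R) -> Prop :=
| quadratic_cst c : quadratic (fun=> c)
| quadratic_coord k : quadratic (fun x => tnth x k)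
| quadratic_coord2 k l : quadratic (fun x => tnth x k * tnth x l)
| quadratic_add F G : quadratic F -> quadratic G -> quadratic (F \+ G)
| quadratic_scale c F : quadratic F -> quadratic (fun x => c * F x).

Definition expect p F : R := \int[mu]_x (F x * p x).

Definition integ p F := mu.-integrable setT (fun x => (F x * p x)%:E).

Definition density p := normalizable_moment2 p /\ \int[mu]_x p x = 1.

Lemma quadratic_sum (J : finType) (F : J -> euclid R n -> R) :
  (forall j, quadratic (F j)) -> quadratic (fun x => \sum_j F j x).
Proof.
move=> qF; elim: (index_enum J) => [|j s IHs].
  rewrite (_ : (fun _ => _) = fun=> 0); first exact: quadratic_cst.
  by apply/funext => x; rewrite big_nil.
rewrite (_ : (fun _ => _) = F j \+ (fun x => \sum_(i <- s) F i x)).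
  exact: quadratic_add.
by apply/funext => x; rewrite big_cons.
Qed.

Lemma quadratic_shift2 (a b : R) k l :
  quadratic (fun x => (tnth x k - a) * (tnth x l - b)).
Proof.
rewrite (_ : (fun _ => _) = (fun x => tnth x k * tnth x l) \+
  ((fun x => (- b) * tnth x k) \+ ((fun x => (- a) * tnth x l) \+ fun=> a * b))).
  apply: quadratic_add; first exact: quadratic_coord2.
  apply: quadratic_add; first by apply: quadratic_scale; exact: quadratic_coord.
  apply: quadratic_add; last exact: quadratic_cst.
  by apply: quadratic_scale; exact: quadratic_coord.
by apply/funext => x /=; ring.
Qed.

Lemma measurable_quadratic F : quadratic F -> measurable_fun setT F.
Proof.
elim=> [c|k|k l|G H _ mG _ mH|c G _ mG] //.
- exact: measurable_tnth.
- by apply: measurable_funM; exact: measurable_tnth.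
- exact: measurable_funD.
- exact: measurable_funM.
Qed.

Lemma integ1 p : normalizable_moment2 p -> mu.-integrable setT (EFin \o p).
Proof.
move=> [mp p0 /andP[_ ip] _]; apply/integrableP; split; first exact/measurable_EFinP.
rewrite (eq_integral (EFin \o p))// => x _.
by rewrite /= ger0_norm.
Qed.

Lemma integ_coord2 p k l : normalizable_moment2 p ->
  integ p (fun x => tnth x k * tnth x l).
Proof.
move=> [mp p0 _ ip2].
have mc j : measurable_fun setT (fun x : euclid R n => tnth x j : R).
  exact: measurable_tnth.
have mpS : measurable_fun setT (fun x => sqnorm x * p x).
  apply: measurable_funM => //; apply: measurable_sum => j.
  exact: measurable_funX.
have s0 (x : euclid R n) : 0 <= sqnorm x by apply: sumr_ge0 => j _; exact: sqr_ge0.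
have ig : mu.-integrable setT (fun x => (sqnorm x * p x)%:E).
  apply/integrableP; split; first exact/measurable_EFinP.
  rewrite (eq_integral (fun x => (sqnorm x * p x)%:E))// => x _.
  by rewrite /= ger0_norm ?mulr_ge0.
apply: (le_integrable _ _ _ ig) => //.
  by apply/measurable_EFinP; do 2 apply: measurable_funM => //.
move=> x _ /=; rewrite lee_fin [leRHS]ger0_norm ?mulr_ge0//.
rewrite normrM (ger0_norm (p0 x)) ler_wpM2r// normrM.
have le1 j : `|tnth x j| ^+ 2 <= sqnorm x.
  by rewrite real_normK ?num_real// /sqnorm (bigD1 j)//= lerDl sumr_ge0// => i _; exact: sqr_ge0.
have := le1 k; have := le1 l; have := sqr_ge0 (`|tnth x k| - `|tnth x l|).
by rewrite sqrrB -mulr_natl; lra.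
Qed.

Lemma integ_coord p k : normalizable_moment2 p -> integ p (fun x => tnth x k).
Proof.
move=> np; have [mp p0 _ _] := np.
have ig : mu.-integrable setT
    ((EFin \o p) \+ (fun x => (tnth x k * tnth x k * p x)%:E))%E.
  by apply: integrableD => //; [exact: integ1|exact: integ_coord2].
apply: (le_integrable _ _ _ ig) => //.
  apply/measurable_EFinP; apply: measurable_funM => //; exact: measurable_tnth.
move=> x _ /=; rewrite lee_fin [leRHS]ger0_norm; last first.
  by rewrite addr_ge0// mulr_ge0// -expr2 sqr_ge0.
rewrite normrM (ger0_norm (p0 x)) -[X in _ <= X + _]mul1r -mulrDl ler_wpM2r//.
rewrite -expr2 -real_normK ?num_real//.
have := sqr_ge0 (`|tnth x k| - 1); have := sqr_ge0 `|tnth x k|.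
by rewrite sqrrB1 -mulr_natl; lra.
Qed.

Lemma integD p F G : integ p F -> integ p G -> integ p (F \+ G).
Proof.
move=> iF iG; have := integrableD measurableT iF iG.
by apply: eq_integrable => // x _; rewrite -EFinD mulrDl.
Qed.

Lemma integZ p c F : integ p F -> integ p (fun x => c * F x).
Proof.
move=> iF; have := integrableZl measurableT c iF.
by apply: eq_integrable => // x _; rewrite -EFinM mulrA.
Qed.

Lemma expectD p F G : integ p F -> integ p G ->
  expect p (F \+ G) = expect p F + expect p G.
Proof.
move=> iF iG; rewrite /expect -RintegralD//.
by apply: eq_Rintegral => x _; rewrite mulrDl.
Qed.

Lemma expectZ p c F : integ p F -> expect p (fun x => c * F x) = c * expect p F.
Proof.
move=> iF; rewrite /expect -RintegralZl//.
by apply: eq_Rintegral => x _; rewrite mulrA.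
Qed.

Lemma integ_quadratic p F : normalizable_moment2 p -> quadratic F -> integ p F.
Proof.
move=> np; elim=> [c|k|k l|G H _ mG _ mH|c G _ mG].
- by have := integrableZl measurableT c (integ1 np).
- exact: integ_coord.
- exact: integ_coord2.
- exact: integD.
- exact: integZ.
Qed.

Lemma expect_cst p c : density p -> expect p (fun=> c) = c.
Proof. by move=> [np p1]; rewrite /expect RintegralZl ?p1 ?mulr1//; exact: integ1. Qed.

Lemma expect_sum p (J : finType) (F : J -> euclid R n -> R) :
  (forall j, integ p (F j)) ->
  expect p (fun x => \sum_j F j x) = \sum_j expect p (F j).
Proof.
move=> iF.
suff [] : integ p (fun x => \sum_j F j x) /\
  expect p (fun x => \sum_j F j x) = \sum_j expect p (F j) by [].
elim: (index_enum J) => [|j s [IHi IHs]].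
  rewrite (_ : (fun _ => _) = fun=> 0); last first.
    by apply/funext => x; rewrite big_nil.
  rewrite big_nil /integ /expect; split.
    by under eq_fun do rewrite mul0r; exact: integrable0.
  under eq_Rintegral do rewrite mul0r.
  by rewrite /Rintegral integral0.
rewrite (_ : (fun _ => _) = F j \+ (fun x => \sum_(i <- s) F i x)); last first.
  by apply/funext => x; rewrite big_cons.
by rewrite big_cons expectD// IHs; split => //; exact: integD.
Qed.

Definition quadratic_eq p q := forall F, quadratic F -> expect p F = expect q F.

Lemma covmx_expect p : density p -> forall k l,
  expect p (fun x => tnth x k * tnth x l) =
  covmx p k l + mean p 0 k * mean p 0 l.
Proof.
move=> dp k l; have [np _] := dp; rewrite [covmx p k l]mxE.
have mE j : mean p 0 j = expect p (fun x => tnth x j) by rewrite mxE.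
rewrite -/(expect p (fun x => (tnth x k - mean p 0 k) * (tnth x l - mean p 0 l))).
rewrite [X in _ = expect _ X + _](_ : _ = (fun x => tnth x k * tnth x l) \+
  ((fun x => (- mean p 0 l) * tnth x k) \+
  ((fun x => (- mean p 0 k) * tnth x l) \+ fun=> mean p 0 k * mean p 0 l))); last first.
  by apply/funext => x /=; ring.
rewrite !expectD ?expectZ ?expect_cst -?mE; try (apply: integ_quadratic => //;
  by do ?[exact: quadratic_cst|exact: quadratic_coord|exact: quadratic_coord2|
     apply: quadratic_add|apply: quadratic_scale]).
  by ring.
exact: dp.
Qed.

Lemma quadratic_eqW p q : normalizable_moment2 p -> normalizable_moment2 q ->
  (forall c, expect p (fun=> c) = expect q (fun=> c)) ->
  (forall k, expect p (fun x => tnth x k) = expect q (fun x => tnth x k)) ->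
  (forall k l, expect p (fun x => tnth x k * tnth x l) =
               expect q (fun x => tnth x k * tnth x l)) ->
  quadratic_eq p q.
Proof.
move=> np nq e0 e1 e2 F; elim=> [c|k|k l|G H qG eG qH eH|c G qG eG] //.
- by rewrite !expectD ?eG ?eH//; exact: integ_quadratic.
- by rewrite !expectZ ?eG//; exact: integ_quadratic.
Qed.

(** Up to products of entries of the mean, the covariance consists of the
    expectations of the monomials of degree two; linearity does the rest. *)
Lemma same_momentsP p q : density p -> density q ->
  same_moments p q <-> quadratic_eq p q.
Proof.
move=> dp dq; have [np _] := dp; have [nq _] := dq; split.
  move=> [me ce]; apply: quadratic_eqW => //.
  - by move=> c; rewrite !expect_cst.
  - by move=> k; have /rowP/(_ k) := me; rewrite !mxE.
  - by move=> k l; rewrite !covmx_expect// me ce.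
move=> qe; have me : mean p = mean q.
  by apply/rowP => k; rewrite !mxE; exact: qe (quadratic_coord k).
split => //; apply/matrixP => k l; rewrite [LHS]mxE [RHS]mxE me.
exact: qe (quadratic_shift2 _ _ k l).
Qed.

Lemma normalizable_moment2P p : measurable_fun setT p -> (forall x, 0 <= p x) ->
  (0 < \int[mu]_x (p x)%:E < +oo)%E ->
  (forall k, \int[mu]_x (tnth x k ^+ 2 * p x)%:E < +oo)%E ->
  normalizable_moment2 p.
Proof.
move=> mp p0 p1 p2; split => //.
under eq_integral do rewrite /sqnorm mulr_suml -sumEFin.
rewrite ge0_integral_sum//; last 2 first.
- move=> k; apply/measurable_EFinP; apply: measurable_funM => //.
  by apply: measurable_funX; exact: measurable_tnth.
- by move=> k x _; rewrite lee_fin mulr_ge0// sqr_ge0.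
by apply: lte_sum_pinfty => k _; exact: p2.
Qed.

Lemma densityP p : measurable_fun setT p -> (forall x, 0 <= p x) ->
  (\int[mu]_x (p x)%:E = 1)%E ->
  (forall k, \int[mu]_x (tnth x k ^+ 2 * p x)%:E < +oo)%E -> density p.
Proof.
move=> mp p0 p1 p2; split; last by rewrite /Rintegral p1.
by apply: normalizable_moment2P => //; rewrite p1 lte01 ltry.
Qed.

Lemma normalizable_moment2_propto p q : propto p q -> normalizable_moment2 q ->
  normalizable_moment2 p /\ normalized p = normalized q.
Proof.
move=> [c c0 pE] nq; have [mq q0 /andP[q1 q1oo] q2] := nq.
have {pE}-> : p = (fun x => c * q x) by exact/funext.
split; last first.
  apply/funext => x; rewrite /normalized RintegralZl//; last exact: integ1.
  by rewrite -mulf_div divff ?gt_eqF// mul1r.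
have s0 (x : euclid R n) : 0 <= sqnorm x by apply: sumr_ge0 => j _; exact: sqr_ge0.
have intZ (F : euclid R n -> R) : measurable_fun setT F -> (forall x, 0 <= F x) ->
    (\int[mu]_x (c * F x)%:E = c%:E * \int[mu]_x (F x)%:E)%E.
  move=> mF F0; under eq_integral do rewrite EFinM.
  rewrite ge0_integralZl//; first exact/measurable_EFinP.
  - by move=> x _; rewrite lee_fin.
  - by rewrite lee_fin ltW.
split.
- exact: measurable_funM.
- by move=> x; rewrite mulr_ge0// ltW.
- by rewrite intZ// mule_gt0 ?lte_fin//= lte_mul_pinfty ?lee_fin ?(ltW c0)//.
- under eq_integral do rewrite mulrCA.
  rewrite intZ ?lte_mul_pinfty ?lee_fin ?(ltW c0)//.
    apply: measurable_funM => //; apply: measurable_sum => j.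
    by apply: measurable_funX; exact: measurable_tnth.
  by move=> x; rewrite mulr_ge0.
Qed.

Lemma density_normalized p : normalizable_moment2 p -> density (normalized p).
Proof.
move=> np; have [mp p0 /andP[p1 p1oo] _] := np.
have pfin : (\int[mu]_x (p x)%:E)%E \is a fin_num by rewrite ge0_fin_numE// ltW.
have Z0 : 0 < \int[mu]_x p x by rewrite fine_gt0// p1.
have pr : propto (normalized p) p.
  exists (\int[mu]_x p x)^-1; first by rewrite invr_gt0.
  by move=> x; rewrite mulrC.
have [nn _] := normalizable_moment2_propto pr np; split => //.
by rewrite /normalized RintegralZr ?divff ?gt_eqF//; exact: integ1.
Qed.

Lemma expect_normalized p F : integ p F ->
  expect (normalized p) F = expect p F / \int[mu]_x p x.
Proof.
move=> iF; rewrite /expect -RintegralZr//.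
by apply: eq_Rintegral => x _; rewrite /normalized mulrA.
Qed.

Lemma same_moments_normalized p q :
  normalizable_moment2 p -> normalizable_moment2 q -> quadratic_eq p q ->
  same_moments (normalized p) (normalized q).
Proof.
move=> np nq e; apply/same_momentsP; try exact: density_normalized.
move=> F qF; rewrite !expect_normalized ?e//; try exact: integ_quadratic.
congr (_ / _); have := e _ (quadratic_cst 1).
by rewrite /expect; under eq_Rintegral do rewrite mul1r;
   under [RHS]eq_Rintegral do rewrite mul1r.
Qed.

Lemma normalized_density p : density p -> normalized p = p.
Proof. by move=> [_ p1]; apply/funext => x; rewrite /normalized p1 divr1. Qed.

End Moments.

(** * Gaussian densities *)

Section Gaussian.
Context {R : realType}.
Local Notation mu := (@lebesgue_euclid R).
Local Notation lam := (@lebesgue_measure R).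
Local Notation phi := (normal_pdf (0 : R) 1).

Definition std_normal n (z : euclid R n) : R := \prod_(k < n) phi (tnth z k).

Lemma std_normal_ge0 n (z : euclid R n) : 0 <= std_normal z.
Proof. by apply: prodr_ge0 => k _; exact: normal_pdf_ge0. Qed.

Lemma measurable_prod_coord n (h : 'I_n -> R -> R) :
  (forall k, measurable_fun setT (h k)) ->
  measurable_fun setT (fun z : euclid R n => \prod_k h k (tnth z k)).
Proof.
move=> mh; apply: measurable_prod => k _.
apply: (measurableT_comp (mh k)); exact: measurable_tnth.
Qed.

Lemma measurable_std_normal n : measurable_fun setT (@std_normal n).
Proof.
by apply: (@measurable_prod_coord _ (fun _ => phi)) => k; exact: measurable_normal_pdf.
Qed.

Lemma integral_prod_coord n (h : 'I_n -> R -> R) :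
  (forall k, measurable_fun setT (h k)) -> (forall k x, 0 <= h k x) ->
  (\int[mu n]_z (\prod_k h k (tnth z k))%:E = \prod_k \int[lam]_x (h k x)%:E)%E.
Proof.
elim: n h => [|n IHn] h mh h0.
  rewrite [RHS]big_ord0 (eq_integral (cst 1%E)); last first.
    by move=> z _; rewrite big_ord0.
  by rewrite integral_cst//= diracT mule1.
rewrite integral_econs; last 2 first.
- by apply/measurable_EFinP; exact: measurable_prod_coord.
- by move=> x; rewrite lee_fin prodr_ge0.
rewrite [RHS]big_ord_recl -IHn//.
rewrite -ge0_integralZr//; last 3 first.
- by apply/measurable_EFinP; exact: mh.
- by move=> x _; rewrite lee_fin; exact: h0.
- by apply: integral_ge0 => z _; rewrite lee_fin prodr_ge0.
apply: eq_integral => a _; rewrite -ge0_integralZl//; last 3 first.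
- by apply/measurable_EFinP; exact: (@measurable_prod_coord _ (fun k => h (lift ord0 k))).
- by move=> z _; rewrite lee_fin prodr_ge0.
- by rewrite lee_fin; exact: h0.
apply: eq_integral => z _; rewrite big_ord_recl -EFinM.
by congr (_ * _)%:E; apply: eq_bigr => k _; rewrite tnthS.
Qed.

Lemma integral_std_normal n : (\int[mu n]_z (std_normal z)%:E = 1)%E.
Proof.
rewrite (@integral_prod_coord _ (fun _ => phi)).
- by rewrite big1// => k _; exact: integral_normal_pdf.
- by move=> k; exact: measurable_normal_pdf.
- by move=> k x; exact: normal_pdf_ge0.
Qed.

Lemma integral_sqr_std_normal n (k : 'I_n) :
  (\int[mu n]_z (tnth z k ^+ 2 * std_normal z)%:E = 1)%E.
Proof.
pose h (j : 'I_n) x := (if j == k then x ^+ 2 else 1) * phi x.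
rewrite (eq_integral (fun z : euclid R n => (\prod_j h j (tnth z j))%:E)); last first.
  move=> z _; rewrite /h /std_normal (bigD1 k)//= [in RHS](bigD1 k)//= eqxx mulrA.
  by congr (_ * _)%:E; apply: eq_bigr => j /negbTE ->; rewrite mul1r.
rewrite integral_prod_coord.
- rewrite big1// => j _; rewrite /h; case: (j == k).
    exact: integral_sqr_normal.
  by under eq_integral do rewrite mul1r; exact: integral_normal_pdf.
- move=> j; apply: measurable_funM; last exact: measurable_normal_pdf.
  by case: (j == k) => //; exact: measurable_funX.
- by move=> j x; rewrite mulr_ge0 ?normal_pdf_ge0//; case: ifP => // _; exact: sqr_ge0.
Qed.

Lemma density_std_normal n : density (@std_normal n).
Proof.
apply: densityP.
- exact: measurable_std_normal.
- exact: std_normal_ge0.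
- exact: integral_std_normal.
- by move=> k; rewrite integral_sqr_std_normal ltry.
Qed.

(** Lebesgue measure and the standard normal density are invariant under the
    reflection of one coordinate, so the moments that are odd in some
    coordinate vanish. *)
Definition reflect_coord n (k : 'I_n) (z : euclid R n) : euclid R n :=
  [tuple if j == k then - tnth z j else tnth z j | j < n].

Lemma measurable_reflect_coord n (k : 'I_n) : measurable_fun setT (reflect_coord k).
Proof.
apply/measurable_fun_tnthP => j.
rewrite (_ : _ \o _ = fun z : euclid R n => if j == k then - tnth z j else tnth z j).
  have mj : measurable_fun setT (fun z : euclid R n => tnth z j : R).
    exact: measurable_tnth.
  by case: (j == k) => //; exact: measurable_funN.
by apply/funext => z /=; rewrite tnth_mktuple.
Qed.

Let pushr n (k : 'I_n) :=
  measure_function_pushforward__canonical__measure_function_Measure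
    (mu n) (measurable_reflect_coord k).

Lemma lebesgue_reflect_coord n (k : 'I_n) S : measurable S ->
  mu n S = pushr k S.
Proof.
apply: lebesgue_euclid_unique => A mA; rewrite /pushr/= /pushforward.
pose A' j := if j == k then -%R @^-1` A j else A j.
rewrite (_ : _ @^-1` _ = box A'); last first.
  apply/seteqP; split => z Az j; have := Az j; rewrite /A' tnth_mktuple;
    by case: (j == k).
have mN : measurable (-%R @^-1` A k : set (measurableTypeR R)).
  rewrite -[X in measurable X]setTI.
  have mopp : measurable_fun setT (-%R : measurableTypeR R -> measurableTypeR R).
    exact: oppr_measurable.
  exact: mopp.
rewrite lebesgue_box; last first.
  by move=> j; rewrite /A'; case: eqP => [->|_].
apply: eq_bigr => j _; rewrite /A'; case: eqP => // ->.
by rewrite -[RHS](lebesgue_measureN (mA k)).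
Qed.

Lemma integral_odd n (k : 'I_n) (f : euclid R n -> R) :
  (mu n).-integrable setT (EFin \o f) ->
  (forall z, f (reflect_coord k z) = - f z) -> \int[mu n]_z f z = 0.
Proof.
move=> fi fodd; suff : \int[mu n]_z f z = - \int[mu n]_z f z by lra.
have [mf _] := integrableP _ _ _ fi.
have fri : (mu n).-integrable setT ((EFin \o f) \o reflect_coord k).
  rewrite (_ : _ \o _ = \- (EFin \o f))%E; first exact: integrableN.
  by apply/funext => z /=; rewrite fodd.
rewrite -[RHS]mulN1r -RintegralZl//; congr fine.
rewrite [LHS](eq_measure_integral (pushr k)); last first.
  by move=> A mA _; exact: lebesgue_reflect_coord.
rewrite (integral_pushforward (measurable_reflect_coord k) mf)// preimage_setT.
by apply: eq_integral => z _; rewrite /= fodd mulN1r.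
Qed.

Lemma std_normal_reflect n (k : 'I_n) (z : euclid R n) :
  std_normal (reflect_coord k z) = std_normal z.
Proof.
apply: eq_bigr => j _; rewrite tnth_mktuple; case: ifP => // _.
by rewrite !normal_pdf0E// sqrrN.
Qed.

Lemma expect_std_normal_coord n (k : 'I_n) :
  expect (@std_normal n) (fun z => tnth z k) = 0.
Proof.
have [nd _] := @density_std_normal n.
apply: (@integral_odd _ k); first exact: integ_coord.
by move=> z; rewrite std_normal_reflect tnth_mktuple eqxx mulNr.
Qed.

Lemma expect_std_normal_coord2 n (k l : 'I_n) :
  expect (@std_normal n) (fun z => tnth z k * tnth z l) = (k == l)%:R.
Proof.
have [nd _] := @density_std_normal n.
have [->|kl] := eqVneq k l.
  rewrite /expect /Rintegral; under eq_integral do rewrite -expr2.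
  by rewrite integral_sqr_std_normal.
apply: (@integral_odd _ k); first exact: integ_coord2.
move=> z; rewrite std_normal_reflect !tnth_mktuple eqxx eq_sym (negbTE kl).
by rewrite !mulNr.
Qed.

Lemma measurable_gauss_pdf n (m : 'rV[R]_n) (S : 'M[R]_n) :
  measurable_fun setT (gauss_pdf m S).
Proof.
apply: measurable_funM => //; apply: measurableT_comp => //.
apply: measurable_funM => //; apply: measurable_funN => //.
rewrite (_ : (fun _ => _) = fun x : euclid R n =>
    \sum_j (\sum_i (tnth x i - m 0 i) * invmx S i j) * (tnth x j - m 0 j)).
  have mt j : measurable_fun setT (fun x : euclid R n => tnth x j - m 0 j : R).
    by apply: measurable_funB => //; exact: measurable_tnth.
  apply: measurable_sum => j; apply: measurable_funM => //.
  by apply: measurable_sum => i; exact: measurable_funM.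
apply/funext => x; rewrite mxE; apply: eq_bigr => j _; rewrite !mxE.
by congr (_ * _); apply: eq_bigr => i _; rewrite !mxE.
Qed.

Lemma gauss_pdf_affine n (m : 'rV[R]_n) (L : 'M[R]_n) z : 0 < \det L ->
  gauss_pdf m (L^T *m L) (affine m L z) = (\det L)^-1 * std_normal z.
Proof.
move=> L0; have uL : L \in unitmx by rewrite unitmxE unitfE gt_eqF.
rewrite /gauss_pdf row_of_vec addrAC subrr add0r.
have -> : row_of z *m L *m invmx (L^T *m L) *m (row_of z *m L)^T =
    row_of z *m (row_of z)^T.
  have -> : invmx (L^T *m L) = invmx L *m invmx L^T.
    apply: (can_inj (mulKmx (_ : L^T *m L \in unitmx))).
      by rewrite unitmx_mul unitmx_tr uL.
    rewrite mulmxV ?unitmx_mul ?unitmx_tr ?uL// mulmxA mulmxK//.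
    by rewrite mulmxV// unitmx_tr.
  by rewrite trmx_mul !mulmxA mulmxK// mulmxKV// unitmx_tr.
have -> : (row_of z *m (row_of z)^T) 0 0 = sqnorm z.
  by rewrite mxE; apply: eq_bigr => k _; rewrite !mxE expr2.
have -> : std_normal z = (Num.sqrt (2 * pi) ^+ n)^-1 * expR (- sqnorm z / 2).
  rewrite /std_normal; under eq_bigr do
    rewrite normal_pdf0E// mul1r expr1n mulr1.
  rewrite big_split/= prodr_const card_ord exprVn; congr (_ * _).
  by rewrite -expR_sum -mulr_suml sumrN.
rewrite mulrA -invfM; congr (_^-1 * _).
have -> : (2 * pi) ^+ n * \det (L^T *m L) = (\det L * Num.sqrt (2 * pi) ^+ n) ^+ 2.
  rewrite det_mulmx det_tr [RHS]exprMn -[in RHS]exprM mulnC exprM sqr_sqrtr.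
    by rewrite -expr2 mulrC.
  by rewrite mulr_ge0// pi_ge0.
by rewrite sqrtr_sqr ger0_norm// mulr_ge0 ?(ltW L0)// exprn_ge0.
Qed.

Lemma gauss_pdf_gt0 n (m : 'rV[R]_n) S x : posdef S -> 0 < gauss_pdf m S x.
Proof.
move=> /cholesky_substitution[L [SE L0 _]].
rewrite mulr_gt0 ?expR_gt0// invr_gt0 sqrtr_gt0 mulr_gt0//.
  by rewrite exprn_gt0// mulr_gt0// pi_gt0.
by rewrite SE det_mulmx det_tr mulr_gt0.
Qed.

(** A Gaussian density is the law of an affine image of a standard normal
    vector.  Both integrals are differences of integrals of positive and
    negative parts, to which the substitution for nonnegative functions
    applies. *)
Lemma gauss_law n (m : 'rV[R]_n) (S : 'M[R]_n) : posdef S ->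
  exists2 L : 'M[R]_n, S = L^T *m L &
    forall F : euclid R n -> R, measurable_fun setT F ->
      (\int[mu n]_x (F x * gauss_pdf m S x)%:E =
       \int[mu n]_z (F (affine m L z) * std_normal z)%:E)%E.
Proof.
move=> posS; have [L [SE L0 Lint]] := cholesky_substitution posS.
exists L => //.
have ge0_law (F : euclid R n -> R) : measurable_fun setT F -> (forall x, 0 <= F x) ->
    (\int[mu n]_x (F x * gauss_pdf m S x)%:E =
     \int[mu n]_z (F (affine m L z) * std_normal z)%:E)%E.
  move=> mF F0.
  have mFg : measurable_fun setT (fun x => (F x * gauss_pdf m S x)%:E).
    apply/measurable_EFinP; apply: measurable_funM => //.
    exact: measurable_gauss_pdf.
  have Fg0 x : (0 <= (F x * gauss_pdf m S x)%:E)%E.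
    by rewrite lee_fin mulr_ge0// ltW// gauss_pdf_gt0.
  have H := Lint m _ mFg Fg0.
  transitivity ((\det L)%:E * \int[mu n]_z
      (F (affine m L z) * gauss_pdf m S (affine m L z))%:E)%E.
    by rewrite H muleA -EFinM divff ?gt_eqF// mul1e.
  rewrite -ge0_integralZl//; last 2 first.
  - exact: (measurableT_comp mFg (measurable_affine m L)).
  - by rewrite lee_fin ltW.
  apply: eq_integral => z _; rewrite -EFinM SE gauss_pdf_affine//; congr EFin.
  by field; rewrite gt_eqF.
move=> F mF; rewrite integralE [RHS]integralE.
have posM (g G : euclid R n -> R) : (forall x, 0 <= g x) ->
    ((fun x => (G x * g x)%:E)^\+ = (fun x => (Num.max (G x) 0 * g x)%:E))%E.
  move=> g0; apply/funext => x; rewrite funeposE.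
  by rewrite -EFin_max maxr_pMl ?mul0r.
have negM (g G : euclid R n -> R) : (forall x, 0 <= g x) ->
    ((fun x => (G x * g x)%:E)^\- = (fun x => (Num.max (- G x) 0 * g x)%:E))%E.
  move=> g0; apply/funext => x; rewrite funenegE.
  by rewrite -EFinN -EFin_max maxr_pMl ?mul0r ?mulNr.
rewrite !posM ?negM; try by move=> x; rewrite ?std_normal_ge0// ltW// gauss_pdf_gt0.
rewrite (ge0_law (fun x => Num.max (F x) 0)); last 2 first.
- exact: measurable_maxr.
- by move=> x; rewrite le_max lexx orbT.
rewrite (ge0_law (fun x => Num.max (- F x) 0))//.
- by apply: measurable_maxr => //; exact: measurable_funN.
- by move=> x; rewrite le_max lexx orbT.
Qed.

Lemma quadratic_affine n (m : 'rV[R]_n) (L : 'M[R]_n) (F : euclid R n -> R) :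
  quadratic F -> quadratic (F \o affine m L).
Proof.
have lin k : quadratic (fun z : euclid R n => m 0 k + \sum_j L j k * tnth z j).
  apply: (@quadratic_add _ _ (fun=> m 0 k)); first exact: quadratic_cst.
  apply: quadratic_sum => j; apply: quadratic_scale; exact: quadratic_coord.
have affE k : (fun z => tnth (affine m L z) k) =
    (fun z : euclid R n => m 0 k + \sum_j L j k * tnth z j).
  apply/funext => z; rewrite tnth_affine; congr (_ + _).
  by apply: eq_bigr => j _; rewrite mulrC.
elim=> [c|k|k l|G H _ qG _ qH|c G _ qG].
- exact: quadratic_cst.
- by rewrite /comp affE; exact: lin.
- rewrite (_ : _ \o _ = (fun z : euclid R n => m 0 k * tnth (affine m L z) l) \+
    fun z => \sum_j L j k * (tnth z j * tnth (affine m L z) l)); last first.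
    apply/funext => z /=; rewrite tnth_affine mulrDl mulr_suml; congr (_ + _).
    by apply: eq_bigr => j _; rewrite mulrCA !mulrA.
  apply: quadratic_add; first by apply: quadratic_scale; rewrite affE.
  apply: quadratic_sum => j; apply: quadratic_scale.
  rewrite (_ : (fun _ => _) = (fun z : euclid R n => m 0 l * tnth z j) \+
    fun z => \sum_i L i l * (tnth z j * tnth z i)); last first.
    apply/funext => z /=; rewrite tnth_affine mulrDr mulr_sumr mulrC; congr (_ + _).
    by apply: eq_bigr => i _; rewrite [RHS]mulrCA (mulrC (L i l)).
  apply: quadratic_add; first by apply: quadratic_scale; exact: quadratic_coord.
  by apply: quadratic_sum => i; apply: quadratic_scale; exact: quadratic_coord2.
- exact: quadratic_add.
- exact: quadratic_scale.
Qed.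

Lemma density_gauss n (m : 'rV[R]_n) (S : 'M[R]_n) : posdef S ->
  density (gauss_pdf m S).
Proof.
move=> posS; have [L _ law] := gauss_law m posS.
have [nd _] := @density_std_normal n.
apply: densityP.
- exact: measurable_gauss_pdf.
- by move=> x; exact/ltW/gauss_pdf_gt0.
- have := law (fun=> 1) (measurable_cst _).
  under eq_integral do rewrite mul1r.
  by under [X in _ = X -> _]eq_integral do rewrite mul1r; move=> ->; exact: integral_std_normal.
- move=> k; have q : quadratic (fun x : euclid R n => tnth x k * tnth x k).
    exact: quadratic_coord2.
  rewrite (law (fun x => tnth x k ^+ 2)); last exact: measurable_quadratic.
  have := integ_quadratic nd (quadratic_affine m L q).
  exact: integrable_lty.
Qed.

Lemma gauss_moments n (m : 'rV[R]_n) (S : 'M[R]_n) : posdef S ->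
  mean (gauss_pdf m S) = m /\ covmx (gauss_pdf m S) = S.
Proof.
move=> posS; have [L SE law] := gauss_law m posS.
have dn := @density_std_normal n; have [nd _] := dn.
have lawE F : quadratic F ->
    expect (gauss_pdf m S) F = expect (@std_normal n) (F \o affine m L).
  by move=> qF; congr fine; apply: law; exact: measurable_quadratic.
have coordE k : (fun x : euclid R n => tnth x k) \o affine m L =
    (fun=> m 0 k) \+ fun z => \sum_j L j k * tnth z j.
  apply/funext => z /=; rewrite tnth_affine; congr (_ + _).
  by apply: eq_bigr => j _; rewrite mulrC.
have qc j : integ (@std_normal n) (fun z => tnth z j) by exact: integ_coord.
have me : mean (gauss_pdf m S) = m.
  apply/rowP => k; rewrite mxE.
  rewrite -/(expect _ (fun x => tnth x k)) lawE; last exact: quadratic_coord.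
  rewrite coordE expectD; last 2 first.
  - exact: integ_quadratic (quadratic_cst _).
  - by apply: integ_quadratic => //; apply: quadratic_sum => j;
      apply: quadratic_scale; exact: quadratic_coord.
  rewrite expect_cst// expect_sum; last by move=> j; exact: integZ.
  rewrite big1 ?addr0// => j _.
  by rewrite expectZ// expect_std_normal_coord mulr0.
split => //; apply/matrixP => k l; rewrite mxE me.
rewrite -/(expect _ (fun x => (tnth x k - m 0 k) * (tnth x l - m 0 l))).
rewrite lawE; last exact: quadratic_shift2.
rewrite (_ : _ \o _ = fun z => \sum_i L i k * (\sum_j L j l * (tnth z i * tnth z j)));
  last first.
  apply/funext => z /=; rewrite !tnth_affine !(addrC (m 0 _)) !addrK mulr_suml.
  apply: eq_bigr => i _; rewrite mulrAC [LHS]mulrC mulr_sumr; congr (_ * _).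
  by apply: eq_bigr => j _; ring.
have qi i : integ (@std_normal n) (fun z => \sum_j L j l * (tnth z i * tnth z j)).
  apply: integ_quadratic => //; apply: quadratic_sum => j; apply: quadratic_scale.
  exact: quadratic_coord2.
rewrite expect_sum; last by move=> i; exact: integZ.
rewrite SE mxE; apply: eq_bigr => i _; rewrite mxE expectZ//; congr (_ * _).
rewrite expect_sum; last by move=> j; apply: integZ; exact: integ_coord2.
rewrite (bigD1 i)//= big1 ?addr0 => [|j /negbTE ji].
  by rewrite expectZ ?expect_std_normal_coord2 ?eqxx ?mulr1//; exact: integ_coord2.
rewrite expectZ ?expect_std_normal_coord2 1?eq_sym ?ji ?mulr0//; exact: integ_coord2.
Qed.

End Gaussian.

(** * Gaussian projection *)

Section Projection.
Context {R : realType} {n : nat}.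
Implicit Types (p q F H : euclid R n -> R).
Local Notation mu := (@lebesgue_euclid R n).

Lemma ae_eq0_of_integral F : measurable_fun setT F -> (forall x, 0 <= F x) ->
  (\int[mu]_x (F x)%:E = 0)%E -> {ae mu, forall x, F x = 0}.
Proof.
move=> mF F0 F1.
have mE : measurable_fun setT (EFin \o F) by exact/measurable_EFinP.
have : (\int[mu]_x `|(EFin \o F) x| = 0)%E.
  by rewrite -[RHS]F1; apply: eq_integral => x _; rewrite /= ger0_norm.
move=> /(ae_eq_integral_abs mu measurableT mE).
by apply: filterS => x /(_ I) [].
Qed.

(** The covariance form of a density at [v] is the second moment of a linear
    function; were it zero, the density would live on a hyperplane, which is a
    null set. *)
Lemma posdef_covmx p : density p -> posdef (covmx p).
Proof.
move=> dp; have [np p1] := dp; have [mp p0 _ _] := np.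
split.
  apply/matrixP => k l; rewrite !mxE; apply: eq_Rintegral => x _.
  by rewrite (mulrC (tnth x l - _)).
move=> v v0; pose m := mean p.
pose f (x : euclid R n) := \sum_k v 0 k * (tnth x k - m 0 k).
have f2E x : f x ^+ 2 =
    \sum_l \sum_k (v 0 l * v 0 k) * ((tnth x k - m 0 k) * (tnth x l - m 0 l)).
  rewrite expr2 /f mulr_suml; apply: eq_bigr => l _; rewrite mulr_sumr.
  by apply: eq_bigr => k _; ring.
have qkl k l c : quadratic (fun x : euclid R n =>
    c * ((tnth x k - m 0 k) * (tnth x l - m 0 l))).
  by apply: quadratic_scale; exact: quadratic_shift2.
have qf : quadratic (fun x => f x ^+ 2).
  rewrite (_ : (fun _ => _) = fun x => \sum_l \sum_k (v 0 l * v 0 k) *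
     ((tnth x k - m 0 k) * (tnth x l - m 0 l))); last exact/funext.
  by do 2 apply: quadratic_sum => ?.
have VE : (v *m covmx p *m v^T) 0 0 = expect p (fun x => f x ^+ 2).
  rewrite (_ : (fun _ => _) = fun x => \sum_l \sum_k (v 0 l * v 0 k) *
     ((tnth x k - m 0 k) * (tnth x l - m 0 l))); last exact/funext.
  rewrite expect_sum; last first.
    by move=> l; apply: integ_quadratic => //; exact: quadratic_sum.
  rewrite mxE; apply: eq_bigr => l _.
  rewrite expect_sum; last by move=> k; exact: integ_quadratic.
  rewrite [(v *m _) 0 l]mxE [v^T l 0]mxE mulr_suml.
  apply: eq_bigr => k _; rewrite expectZ; last first.
    by apply: integ_quadratic => //; exact: quadratic_shift2.
  by rewrite [covmx p k l]mxE (mulrC (v 0 l)) mulrAC.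
have f2p0 x : 0 <= f x ^+ 2 * p x by rewrite mulr_ge0// sqr_ge0.
rewrite VE lt_neqAle Rintegral_ge0// andbT; apply/negP => /eqP V0.
have mf2 := measurable_quadratic qf.
have : {ae mu, forall x, f x ^+ 2 * p x = 0}.
  apply: ae_eq0_of_integral => //; first exact: measurable_funM.
  have /fineK := integrable_fin_num measurableT (integ_quadratic np qf).
  by move=> <-; congr EFin; exact/esym.
have : {ae mu, forall x, ~ hyperplane v (\sum_k v 0 k * m 0 k) x}.
  exists (hyperplane v (\sum_k v 0 k * m 0 k)); split.
  - exact: measurable_hyperplane.
  - exact: lebesgue_hyperplane.
  - by move=> x /= /contrapT.
move=> ae1 ae2; have : (\int[mu]_x (p x)%:E = \int[mu]_x (cst 0%E x))%E.
  apply: ae_eq_integral => //; first exact/measurable_EFinP.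
  apply: filterS2 ae1 ae2 => x Nx /eqP; rewrite mulf_eq0 sqrf_eq0 => fp _.
  case/orP: fp => /eqP fx; last by rewrite fx.
  exfalso; apply: Nx; apply/eqP; rewrite -subr_eq0 -sumrB -[X in _ == X]fx.
  by apply/eqP/eq_bigr => k _; rewrite mulrBr.
rewrite integral0 => p00; move: p1; rewrite /Rintegral p00 => /eqP.
by rewrite eq_sym oner_eq0.
Qed.

Lemma quadratic_ln_gauss m S : posdef S ->
  quadratic (fun x : euclid R n => ln (gauss_pdf m S x)).
Proof.
move=> posS; pose c := (Num.sqrt ((2 * pi) ^+ n * \det S))^-1.
have c0 : 0 < c.
  have := gauss_pdf_gt0 m (vec 0 : euclid R n) posS.
  by rewrite /gauss_pdf -/c pmulr_lgt0// expR_gt0.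
rewrite (_ : (fun _ => _) = (fun=> ln c) \+ fun x => - 2^-1 *
   \sum_j \sum_i invmx S i j * ((tnth x i - m 0 i) * (tnth x j - m 0 j))).
  apply: quadratic_add; first exact: quadratic_cst.
  apply: quadratic_scale; do 2 apply: quadratic_sum => ?.
  by apply: quadratic_scale; exact: quadratic_shift2.
apply/funext => x; rewrite /gauss_pdf lnM ?posrE ?expR_gt0// expRK -/c.
congr (_ + _); rewrite mulNr mulNr mulrC; congr (- (_ * _)).
rewrite mxE; apply: eq_bigr => j _; rewrite !mxE mulr_suml.
by apply: eq_bigr => i _; rewrite !mxE; ring.
Qed.

Definition klfun p q : euclid R n -> R := fun x => p x * ln (p x / q x).

Lemma klfunE p q x : 0 <= p x -> 0 < q x ->
  klfun p q x = p x * ln (p x) - ln (q x) * p x.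
Proof.
move=> p0 q0; rewrite /klfun; have [->|p1] := eqVneq (p x) 0.
  by rewrite !mul0r mulr0 subrr.
have pp : 0 < p x by rewrite lt_neqAle eq_sym p1.
by rewrite ln_div ?posrE//; ring.
Qed.

Lemma measurable_klfun p m S : measurable_fun setT p -> (forall x, 0 <= p x) ->
  posdef S -> measurable_fun setT (klfun p (gauss_pdf m S)).
Proof.
move=> mp p0 posS.
rewrite (_ : klfun _ _ = fun x => p x * ln (p x) - ln (gauss_pdf m S x) * p x).
  apply: measurable_funB; apply: measurable_funM => //.
    exact: measurableT_comp.
  exact: measurable_quadratic (quadratic_ln_gauss m posS).
by apply/funext => x; rewrite klfunE// gauss_pdf_gt0.
Qed.

Lemma ln_le_sub1 (x : R) : 0 < x -> ln x <= x - 1.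
Proof. by move=> x0; have := expR_ge1Dx (ln x); rewrite lnK ?posrE//; lra. Qed.

(** The equality case of [ln y <= y - 1] at [y = b / a]. *)
Lemma mul_ln_eq (a b : R) : 0 < a -> 0 < b ->
  (ln a - ln b) * a = a - b -> a = b.
Proof.
move=> a0 b0 e; apply/eqP; rewrite -subr_eq0.
have ba0 : 0 < b / a by rewrite divr_gt0.
have {e} e : ln (b / a) = b / a - 1.
  apply: (mulIf (lt0r_neq0 a0)); rewrite ln_div ?posrE// [RHS]mulrBl divfK ?gt_eqF//.
  by rewrite mul1r -opprB mulNr e opprB.
have [l0|/expR_gt1Dx] := eqVneq (ln (b / a)) 0; last by rewrite lnK ?posrE// e; lra.
have ba1 : b / a = 1 by rewrite -[LHS]lnK ?posrE// l0 expR0.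
by rewrite -[X in _ - X](divfK (lt0r_neq0 a0)) ba1 mul1r subrr.
Qed.

(** The inequality [ln y <= y - 1] at [y = q x / p x].  It bounds the integrand
    of the relative entropy below by an integrable function. *)
Lemma klfun_ge p q x : 0 <= p x -> 0 < q x -> p x - q x <= klfun p q x.
Proof.
move=> p0 q0; rewrite /klfun; have [->|p1] := eqVneq (p x) 0.
  by rewrite mul0r sub0r oppr_le0 ltW.
have pp : 0 < p x by rewrite lt_neqAle eq_sym p1.
have := ln_le_sub1 (divr_gt0 q0 pp); rewrite -invf_div lnV ?posrE ?divr_gt0//.
rewrite lerNl opprB => le1; apply: le_trans (ler_wpM2l p0 le1).
by rewrite mulrBr mulr1 invf_div mulrCA divff// mulr1.
Qed.

(** The lower bound dominates the negative part, so that integrability can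
    fail only through the positive part. *)
Lemma integral_pinfty F H : measurable_fun setT F ->
  mu.-integrable setT (EFin \o H) -> (forall x, H x <= F x) ->
  ~ mu.-integrable setT (EFin \o F) -> (\int[mu]_x (F x)%:E = +oo)%E.
Proof.
move=> mF iH HF nF; have mE : measurable_fun setT (EFin \o F) by exact/measurable_EFinP.
have Nfin : (\int[mu]_x (EFin \o F)^\- x < +oo)%E.
  have /integrableP[mH] := iH; apply: le_lt_trans.
  apply: ge0_le_integral => //.
  - exact: measurable_funeneg.
  - exact: measurableT_comp.
  move=> x _; rewrite funenegE /= ge_max !lee_fin normr_ge0 andbT.
  by have := ler_norm (- H x); have := HF x; rewrite normrN; lra.
have Poo : (\int[mu]_x (EFin \o F)^\+ x = +oo)%E.
  apply: contrapT => /eqP; rewrite -ltey => Pfin; apply: nF.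
  apply/integrableP; split => //.
  rewrite (eq_integral ((EFin \o F)^\+ \+ (EFin \o F)^\-)%E); last first.
    by move=> x _; exact: (congr1 (@^~ x) (fune_abse (EFin \o F))).
  rewrite ge0_integralD//; last 2 first.
  - exact: measurable_funepos.
  - exact: measurable_funeneg.
  by rewrite lte_add_pinfty.
rewrite integralE Poo addye// eqe_oppLR /= -ltey//.
Qed.

(** The part of the relative entropy that depends on its second argument is
    the expectation of a quadratic function, hence finite; so the relative
    entropies of [p] to all Gaussians are infinite together. *)
Lemma KL_shift p (m : 'rV[R]_n) (S : 'M[R]_n) (m' : 'rV[R]_n) (S' : 'M[R]_n) :
  density p -> posdef S -> posdef S' ->
  let g := gauss_pdf m S in let g' := gauss_pdf m' S' in
  (KL p g' = KL p g + (expect p (fun x => ln (g x) - ln (g' x)))%:E)%E.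
Proof.
move=> [np p1] posS posS' g g'; have [mp p0 _ _] := np.
have qD : quadratic (fun x => ln (g x) - ln (g' x)).
  rewrite (_ : (fun _ => _) = (fun x => ln (g x)) \+ (fun x => -1 * ln (g' x))).
    apply: quadratic_add; first exact: quadratic_ln_gauss.
    by apply: quadratic_scale; exact: quadratic_ln_gauss.
  by apply/funext => x /=; rewrite mulN1r.
have iD := integ_quadratic np qD.
have DE : (\int[mu]_x ((ln (g x) - ln (g' x)) * p x)%:E)%E =
    (expect p (fun x => ln (g x) - ln (g' x)))%:E.
  by rewrite [RHS]fineK//; exact: integrable_fin_num.
have g0 x : 0 < g x by exact: gauss_pdf_gt0.
have g'0 x : 0 < g' x by exact: gauss_pdf_gt0.
have FE x : klfun p g' x = klfun p g x + (ln (g x) - ln (g' x)) * p x.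
  by rewrite !klfunE// mulrBl addrA subrK.
have ig (m0 : 'rV[R]_n) (S0 : 'M[R]_n) : posdef S0 ->
    mu.-integrable setT (EFin \o (fun x => p x - gauss_pdf m0 S0 x)).
  move=> pS; have [ng _] := density_gauss m0 pS.
  by have := integrableB measurableT (integ1 np) (integ1 ng).
have [iF|nF] := pselect (mu.-integrable setT (EFin \o klfun p g)).
  rewrite -DE /KL -integralD//.
  by apply: eq_integral => x _; rewrite -EFinD -FE.
have nF' : ~ mu.-integrable setT (EFin \o klfun p g').
  move=> iF'; apply: nF; have := integrableB measurableT iF' iD.
  by apply: eq_integrable => // x _; rewrite /= -EFinB FE addrK.
rewrite /KL -/(klfun p g') -/(klfun p g).
have Kg := integral_pinfty (measurable_klfun m mp p0 posS) (ig m S posS)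
  (fun x => klfun_ge (p0 x) (g0 x)) nF.
have Kg' := integral_pinfty (measurable_klfun m' mp p0 posS') (ig m' S' posS')
  (fun x => klfun_ge (p0 x) (g'0 x)) nF'.
by rewrite [LHS]Kg' [X in (_ = X + _)%E]Kg.
Qed.

Lemma KL_gtNy p (m : 'rV[R]_n) (S : 'M[R]_n) :
  density p -> posdef S -> KL p (gauss_pdf m S) != -oo%E.
Proof.
move=> [np _] posS; have [mp p0 _ _] := np.
have [ng _] := density_gauss m posS.
have [iF|nF] := pselect (mu.-integrable setT (EFin \o klfun p (gauss_pdf m S))).
  by have := integrable_fin_num measurableT iF; rewrite fin_numE => /andP[].
have igp : mu.-integrable setT (EFin \o (fun x => p x - gauss_pdf m S x)).
  by have := integrableB measurableT (integ1 np) (integ1 ng).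
have Kg := integral_pinfty (measurable_klfun m mp p0 posS) igp
  (fun x => klfun_ge (p0 x) (gauss_pdf_gt0 m x posS)) nF.
by rewrite [KL _ _]Kg.
Qed.

(** The parameters are the moments, and these are integrals. *)
Lemma gauss_pdf_inj (m : 'rV[R]_n) (S : 'M[R]_n) (m' : 'rV[R]_n)
    (S' : 'M[R]_n) :
  posdef S -> posdef S' ->
  {ae mu, forall x, gauss_pdf m S x = gauss_pdf m' S' x} -> m = m' /\ S = S'.
Proof.
move=> posS posS' ae.
have [me ce] := gauss_moments m posS; have [me' ce'] := gauss_moments m' posS'.
have eq F : measurable_fun setT F ->
    \int[mu]_x (F x * gauss_pdf m S x) = \int[mu]_x (F x * gauss_pdf m' S' x).
  move=> mF; have mFg m0 S0 : measurable_fun setT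
      (fun x => (F x * gauss_pdf m0 S0 x)%:E).
    apply/measurable_EFinP; apply: measurable_funM => //.
    exact: measurable_gauss_pdf.
  rewrite /Rintegral (ae_eq_integral _ _ measurableT (mFg m S) (mFg m' S'))//.
  by apply: filterS ae => x -> _.
have mm : m = m'.
  rewrite -[LHS]me -[RHS]me'; apply/rowP => k; rewrite [LHS]mxE [RHS]mxE.
  by apply: eq; exact: measurable_tnth.
subst m'; split => //; rewrite -[LHS]ce -[RHS]ce'; apply/matrixP => k l.
rewrite [LHS]mxE [RHS]mxE me me'.
exact: (eq (fun x => (tnth x k - m 0 k) * (tnth x l - m 0 l))
  (measurable_quadratic (quadratic_shift2 _ _ k l))).
Qed.

(** The integrand is at least the difference of the two densities, which
    integrates to [0]; when the bound is attained the two agree almost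
    everywhere, and so do the densities. *)
Lemma gibbs (m : 'rV[R]_n) (S : 'M[R]_n) (m' : 'rV[R]_n) (S' : 'M[R]_n) :
  posdef S -> posdef S' ->
  let D := expect (gauss_pdf m S)
    (fun x => ln (gauss_pdf m S x) - ln (gauss_pdf m' S' x)) in
  0 <= D /\ (D = 0 -> m = m' /\ S = S').
Proof.
move=> posS posS'; move=> /=; set g := gauss_pdf m S; set q := gauss_pdf m' S'.
set D := expect _ _.
have dg := density_gauss m posS; have [ng g1] := dg.
have [nq q1] := density_gauss m' posS'.
have g0 x : 0 < g x by exact: gauss_pdf_gt0.
have q0 x : 0 < q x by exact: gauss_pdf_gt0.
have qD : quadratic (fun x => ln (g x) - ln (q x)).
  rewrite (_ : (fun _ => _) = (fun x => ln (g x)) \+ (fun x => -1 * ln (q x))).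
    apply: quadratic_add; first exact: quadratic_ln_gauss.
    by apply: quadratic_scale; exact: quadratic_ln_gauss.
  by apply/funext => x /=; rewrite mulN1r.
have iD := integ_quadratic ng qD.
pose h x := (ln (g x) - ln (q x)) * g x - (g x - q x).
have kE x : klfun g q x = (ln (g x) - ln (q x)) * g x.
  by rewrite (klfunE (ltW (g0 x)) (q0 x)) mulrBl (mulrC (g x)).
have h0 x : 0 <= h x by rewrite /h subr_ge0 -kE; apply: klfun_ge => //; exact: ltW.
have igq : mu.-integrable setT (EFin \o (fun x => g x - q x)).
  by have := integrableB measurableT (integ1 ng) (integ1 nq).
have hD : \int[mu]_x h x = D.
  rewrite /h (RintegralB measurableT iD igq).
  by rewrite (RintegralB measurableT (integ1 ng) (integ1 nq)) g1 q1 subrr subr0.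
have ih : mu.-integrable setT (EFin \o h).
  by have := integrableB measurableT iD igq.
split; first by rewrite -hD Rintegral_ge0.
move=> D0; apply: gauss_pdf_inj => //.
have : {ae mu, forall x, h x = 0}.
  apply: ae_eq0_of_integral => //.
    by apply/measurable_EFinP; case/integrableP: ih.
  have /fineK := integrable_fin_num measurableT ih => <-.
  by congr EFin; rewrite -[RHS]D0 -hD.
apply: filterS => x; rewrite -/g -/q /h => hx.
by apply: mul_ln_eq => //; apply/eqP; rewrite -subr_eq0; apply/eqP.
Qed.

(** Relative entropies to two Gaussians differ by the expectation of a
    quadratic function, in which [p] may be replaced by the Gaussian [g] with
    the same moments; minimality is then Gibbs' inequality for [g].  When the
    relative entropies are infinite, the moments of [q] are prescribed. *)
Lemma gaussian_projectionP p q : density p ->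
  gaussian_projection p q <-> q = gauss_pdf (mean p) (covmx p).
Proof.
move=> dp; have posC := posdef_covmx dp.
have [g gE] : exists g, g = gauss_pdf (mean p) (covmx p) by eexists.
have dg : density g by rewrite gE; exact: density_gauss.
have isg : is_gaussian g by rewrite gE; exists (mean p), (covmx p).
have [mg cg] : mean g = mean p /\ covmx g = covmx p.
  by rewrite gE; exact: gauss_moments.
have pg : quadratic_eq p g by apply/same_momentsP.
have Kg : KL p g != -oo%E by rewrite gE; exact: KL_gtNy.
pose D m S := expect g (fun x => ln (g x) - ln (gauss_pdf m S x)).
have D0 m S : posdef S -> 0 <= D m S.
  by rewrite /D gE => posS; have [] := gibbs (mean p) m posC posS.
have Deq m S : posdef S -> D m S = 0 -> g = gauss_pdf m S.
  rewrite /D gE => posS; have [_ H] := gibbs (mean p) m posC posS.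
  by move=> /H[-> ->].
have shift m S : posdef S -> (KL p (gauss_pdf m S) = KL p g + (D m S)%:E)%E.
  move=> posS; rewrite /D -pg; last first.
    rewrite gE (_ : (fun _ => _) = (fun x => ln (gauss_pdf (mean p) (covmx p) x)) \+
        (fun x => -1 * ln (gauss_pdf m S x))).
      apply: quadratic_add; first exact: quadratic_ln_gauss.
      by apply: quadratic_scale; exact: quadratic_ln_gauss.
    by apply/funext => x /=; rewrite mulN1r.
  by rewrite gE; exact: KL_shift.
have gM m S : mean p = m -> covmx p = S -> gauss_pdf m S = g.
  by move=> <- <-; rewrite gE.
rewrite -gE {gE}.
split => [[[m [S [posS /funext ->]]] qmin qoo]|->].
  have [Koo|Kfin] := eqVneq (KL p (gauss_pdf m S)) +oo%E.
    have [me ce] := qoo Koo; have [mq cq] := gauss_moments m posS.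
    by apply: gM; rewrite ?me ?ce.
  have := qmin _ isg; rewrite shift// => le1; apply/esym/Deq => //.
  have Kgfin : KL p g \is a fin_num.
    rewrite fin_numE Kg/=; apply: contra_neq Kfin => Kgoo.
    by rewrite shift// Kgoo addye.
  apply/eqP; rewrite eq_le D0// andbT.
  by move: le1; rewrite -(fineK Kgfin) -EFinD lee_fin gerDl.
split => // q' [m [S [posS /funext ->]]].
by rewrite shift// leeDl// lee_fin D0.
Qed.

End Projection.

(** * Replacing the factor of one block *)

Section BlockMoments.
Context {R : realType} {n : nat} (B : {set 'I_n}).
Local Notation mu := (@lebesgue_euclid R).

Lemma off_blockM (v w : euclid R n -> R) : off_block B v -> off_block B w ->
  off_block B (fun x => v x * w x).
Proof. by move=> ov ow x y xy; rewrite (ov x y)// (ow x y). Qed.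

Lemma off_block_coord k : k \notin B -> off_block B (fun x : euclid R n => tnth x k).
Proof. by move=> kB x y; apply. Qed.

Lemma tnth_block_rank (k : 'I_n) (kB : k \in B) (x : euclid R n) :
  tnth (block B x) (enum_rank_in kB k) = tnth x k.
Proof. by rewrite tnth_mktuple enum_rankK_in. Qed.

Variables (p g : euclid R #|B| -> R) (c : euclid R n -> R).
Hypotheses (dp : density p) (dg : density g) (pg : same_moments p g).
Hypotheses (mc : measurable_fun setT c) (c0 : forall x, 0 <= c x).
Hypothesis oc : off_block B c.
Let pc x := p (block B x) * c x.
Let gc x := g (block B x) * c x.
Hypothesis ngc : normalizable_moment2 gc.

Let np : normalizable_moment2 p. Proof. by case: dp. Qed.
Let ng : normalizable_moment2 g. Proof. by case: dg. Qed.
Let qpg : quadratic_eq p g. Proof. exact/same_momentsP. Qed.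

Let ge0_subst (u : euclid R #|B| -> R) (v : euclid R n -> R) :
  quadratic u -> (forall a, 0 <= u a) ->
  measurable_fun setT v -> (forall x, 0 <= v x) -> off_block B v ->
  (\int[mu n]_x (u (block B x) * v x * pc x)%:E =
   \int[mu n]_x (u (block B x) * v x * gc x)%:E)%E.
Proof.
move=> qu u0 mv v0 ov; have [mp p0 _ _] := np; have [mg g0 _ _] := ng.
have E (h : euclid R #|B| -> R) x : u (block B x) * v x * (h (block B x) * c x) =
  u (block B x) * h (block B x) * (v x * c x) by rewrite mulrACA.
under eq_integral do rewrite E; under [in RHS]eq_integral do rewrite E.
have mu_ := measurable_quadratic qu.
apply: (@ge0_integral_block_subst _ _ B (fun a => u a * p a) (fun a => u a * g a)
  (fun x => v x * c x)); try by do ?[exact: measurable_funM|move=> x; exact: mulr_ge0].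
  exact: off_blockM.
have /fineK <- := integrable_fin_num measurableT (integ_quadratic np qu).
have /fineK <- := integrable_fin_num measurableT (integ_quadratic ng qu).
by congr EFin; exact: qpg.
Qed.

Let mpc : measurable_fun setT pc.
Proof.
have [mp _ _ _] := np; apply: measurable_funM => //.
by apply: (measurableT_comp mp); exact: measurable_block.
Qed.

Let mass : (\int[mu n]_x (pc x)%:E = \int[mu n]_x (gc x)%:E)%E.
Proof.
have := @ge0_subst (fun=> 1) (fun=> 1) (quadratic_cst _) (fun=> ler01)
  (measurable_cst _) (fun=> ler01) (fun _ _ _ => erefl).
by under eq_integral do rewrite !mul1r; under [in RHS]eq_integral do rewrite !mul1r.
Qed.

Let npc : normalizable_moment2 pc.
Proof.
have [mp p0 _ _] := np; have [mgc gc0 gc1 gc2] := ngc.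
apply: normalizable_moment2P => //.
- by move=> x; exact: mulr_ge0.
- by rewrite mass.
move=> k.
have gk : (\int[mu n]_x (tnth x k ^+ 2 * gc x)%:E < +oo)%E.
  by have := integ_coord2 k k ngc; exact: integrable_lty.
have mk : measurable_fun setT (fun x : euclid R n => tnth x k ^+ 2 : R).
  by apply: measurable_funX; exact: measurable_tnth.
have [kB|kB] := boolP (k \in B).
- pose i := enum_rank_in kB k.
  have := @ge0_subst (fun a => tnth a i * tnth a i) (fun=> 1)
    (quadratic_coord2 _ _) (fun a => sqr_ge0 _) (measurable_cst _)
    (fun=> ler01) (fun _ _ _ => erefl).
  under eq_integral do rewrite mulr1 tnth_block_rank.
  by under [in RHS]eq_integral do rewrite mulr1 tnth_block_rank; move=> ->.
- have := @ge0_subst (fun=> 1) (fun x => tnth x k ^+ 2) (quadratic_cst _)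
    (fun=> ler01) mk (fun x => sqr_ge0 _).
  under eq_integral do rewrite mul1r.
  under [in RHS]eq_integral do rewrite mul1r.
  by move=> -> //; apply: off_blockM; exact: off_block_coord.
Qed.

Let expect_subst (u : euclid R #|B| -> R) (v : euclid R n -> R) :
  quadratic u -> off_block B v -> quadratic (fun x => u (block B x) * v x) ->
  expect pc (fun x => u (block B x) * v x) = expect gc (fun x => u (block B x) * v x).
Proof.
move=> qu ov quv.
have := @integral_block_subst _ _ B (fun a => u a * p a) (fun a => u a * g a)
  (fun x => v x * c x) (integ_quadratic np qu) (integ_quadratic ng qu).
rewrite /expect /Rintegral => H; congr fine; move: H.
have E (h : euclid R #|B| -> R) x : u (block B x) * v x * (h (block B x) * c x) =
  u (block B x) * h (block B x) * (v x * c x) by rewrite mulrACA.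
have ip := integ_quadratic npc quv; have ig := integ_quadratic ngc quv.
under [X in _ -> X = _]eq_integral do rewrite E.
under [X in _ -> _ = X]eq_integral do rewrite E.
apply.
- by move: ip; apply: eq_integrable => // x _; rewrite E.
- by move: ig; apply: eq_integrable => // x _; rewrite E.
- exact: off_blockM.
have /fineK <- := integrable_fin_num measurableT (integ_quadratic np qu).
have /fineK <- := integrable_fin_num measurableT (integ_quadratic ng qu).
by congr EFin; exact: qpg.
Qed.

Let quadratic_eq_subst : quadratic_eq pc gc.
Proof.
have e1 u : quadratic u -> quadratic (fun x : euclid R n => u (block B x)) ->
    expect pc (fun x => u (block B x)) = expect gc (fun x => u (block B x)).
  move=> qu qub; have := @expect_subst u (fun=> 1) qu (fun _ _ _ => erefl).
  by under eq_fun do rewrite mulr1; move=> /(_ qub).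
have e2 v : off_block B v -> quadratic v -> expect pc v = expect gc v.
  move=> ov qv; have := @expect_subst (fun=> 1) v (quadratic_cst _) ov.
  by under eq_fun do rewrite mul1r; move=> /(_ qv).
have coordE k (kB : k \in B) : (fun x : euclid R n => tnth x k) =
    fun x => tnth (block B x) (enum_rank_in kB k).
  by apply/funext => x; rewrite tnth_block_rank.
apply: quadratic_eqW => //.
- by move=> a; apply: e2 => //; exact: quadratic_cst.
- move=> k; have [kB|kB] := boolP (k \in B).
    rewrite (coordE k kB); apply: (e1 (fun a => tnth a _)).
      exact: quadratic_coord.
    by rewrite -coordE; exact: quadratic_coord.
  by apply: e2; [exact: off_block_coord|exact: quadratic_coord].
have mixed k l : k \in B -> l \notin B ->
    expect pc (fun x => tnth x k * tnth x l) = expect gc (fun x => tnth x k * tnth x l).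
  move=> kB lB; have E : (fun x : euclid R n => tnth x k * tnth x l) =
      fun x => tnth (block B x) (enum_rank_in kB k) * tnth x l.
    by apply/funext => x; rewrite tnth_block_rank.
  rewrite E; apply: (expect_subst (u := fun a => tnth a _)).
  - exact: quadratic_coord.
  - exact: off_block_coord.
  - by rewrite -E; exact: quadratic_coord2.
move=> k l; have [kB|kB] := boolP (k \in B); have [lB|lB] := boolP (l \in B).
- have E : (fun x : euclid R n => tnth x k * tnth x l) =
      fun x => tnth (block B x) (enum_rank_in kB k) *
               tnth (block B x) (enum_rank_in lB l).
    by apply/funext => x; rewrite !tnth_block_rank.
  rewrite E; apply: (e1 (fun a => tnth a _ * tnth a _)).
    exact: quadratic_coord2.
  by rewrite -E; exact: quadratic_coord2.
- exact: mixed.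
- by under eq_fun do rewrite mulrC; exact: mixed.
- apply: e2; last exact: quadratic_coord2.
  by apply: off_blockM; exact: off_block_coord.
Qed.

(** Given the other coordinates, only the mass and the first two moments of
    the block factor enter the first two moments of the product; so a factor
    may be traded for any other with the same ones. *)
Lemma same_moments_block_subst :
  normalizable_moment2 (fun x => p (block B x) * c x) /\
  same_moments (normalized (fun x => p (block B x) * c x))
               (normalized (fun x => g (block B x) * c x)).
Proof.
split; first exact: npc.
exact: same_moments_normalized npc ngc quadratic_eq_subst.
Qed.

End BlockMoments.

(** * Products of Gaussian densities over the blocks of a partition *)

Section BlockGaussian.
Context {R : realType} {n : nat} {I : finType} (B : I -> {set 'I_n}).
Hypothesis B_disjoint : forall i j : I, i != j -> [disjoint B i & B j]%bool.
Hypothesis B_cover : forall k : 'I_n, exists i : I, k \in B i.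

(** Multiplication on the right by the transpose of [block_sel i] extracts the
    coordinates of block [i]; the three identities that follow express that the
    blocks decompose the space orthogonally. *)
Definition block_sel (i : I) : 'M[R]_(#|B i|, n) :=
  \matrix_(a, k) (enum_val a == k)%:R.
Local Notation E := block_sel.

Lemma row_of_block i (x : euclid R n) : row_of (block (B i) x) = row_of x *m (E i)^T.
Proof.
apply/rowP => a; rewrite !mxE tnth_mktuple (bigD1 (enum_val a))//= big1.
  by rewrite !mxE eqxx mulr1 addr0.
by move=> k /negbTE ka; rewrite !mxE eq_sym ka mulr0.
Qed.

Lemma block_selM i j : i != j -> E i *m (E j)^T = 0.
Proof.
move=> ij; apply/matrixP => a b; rewrite !mxE big1// => k _; rewrite !mxE.
have [ak|] := eqVneq (enum_val a) k; last by rewrite mul0r.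
have [bk|] := eqVneq (enum_val b) k; last by rewrite mulr0.
have /pred0P/(_ k) := B_disjoint ij.
by rewrite /= -{1}ak enum_valP -bk enum_valP.
Qed.

Lemma block_selMid i : E i *m (E i)^T = 1%:M.
Proof.
apply/matrixP => a b; rewrite !mxE (bigD1 (enum_val a))//= big1.
  by rewrite !mxE eqxx mul1r addr0 (inj_eq enum_val_inj) eq_sym.
by move=> k /negbTE ka; rewrite !mxE eq_sym ka mul0r.
Qed.

Lemma block_sel_sum : \sum_i (E i)^T *m E i = 1%:M.
Proof.
apply/matrixP => k l; rewrite summxE.
have [i ki] := B_cover k.
have entry j : ((E j)^T *m E j) k l = ((k \in B j) && (k == l))%:R.
  rewrite mxE (eq_bigr (fun a : 'I_#|B j| =>
      (fun m => ((m == k) && (m == l))%:R) (enum_val a))); last first.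
    by move=> a _; rewrite !mxE -natrM mulnb.
  rewrite -(big_enum_val (fun m => ((m == k) && (m == l))%:R)).
  have [kj|kj] := boolP (k \in B j).
    rewrite (bigD1 k)//= eqxx big1 ?addr0// => m /andP[_ /negbTE ->//].
  by rewrite big1// => m mj; case: eqP => // mk; rewrite -mk mj in kj.
rewrite (bigD1 i)//= entry ki big1 ?addr0 ?mxE// => j ji; rewrite entry.
have /pred0P/(_ k) := B_disjoint ji; rewrite /= ki andbT => -> //.
Qed.

Definition block_params := forall i : I, 'rV[R]_#|B i| * 'M[R]_#|B i|.
Implicit Types theta : block_params.

Definition block_mean theta : 'rV[R]_n := \sum_i (theta i).1 *m E i.

Definition block_diag (S : forall i, 'M[R]_#|B i|) : 'M[R]_n :=
  \sum_i (E i)^T *m S i *m E i.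

Definition block_cov theta := block_diag (fun i => (theta i).2).

Definition block_gauss theta (i : I) (x : euclid R n) : R :=
  gauss_pdf (theta i).1 (theta i).2 (block (B i) x).

Definition block_gaussian theta : euclid R n -> R :=
  gauss_pdf (block_mean theta) (block_cov theta).

Lemma block_form (S : forall i, 'M[R]_#|B i|) (v : 'rV[R]_n) :
  v *m block_diag S *m v^T =
  \sum_i (v *m (E i)^T) *m S i *m (v *m (E i)^T)^T.
Proof.
rewrite mulmx_sumr mulmx_suml; apply: eq_bigr => i _.
by rewrite trmx_mul trmxK !mulmxA.
Qed.

Lemma posdef_block_diag (S : forall i, 'M[R]_#|B i|) :
  (forall i, posdef (S i)) -> posdef (block_diag S).
Proof.
move=> posS; split.
  rewrite /block_diag linear_sum/=; apply: eq_bigr => i _.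
  by rewrite !trmx_mul trmxK; case: (posS i) => -> _; rewrite mulmxA.
move=> v v0; rewrite block_form summxE.
have ge0 i : 0 <= (v *m (E i)^T *m S i *m (v *m (E i)^T)^T) 0 0.
  have [->|w0] := eqVneq (v *m (E i)^T) 0; first by rewrite !mul0mx mxE.
  by apply: ltW; case: (posS i) => _; apply.
have [i wi0] : exists i, v *m (E i)^T != 0.
  apply/existsP; apply: contra_neqT v0 => /existsPn v0.
  rewrite -[v]mulmx1 -block_sel_sum mulmx_sumr big1// => i _.
  by rewrite mulmxA; have /negPn/eqP -> := v0 i; rewrite mul0mx.
rewrite (bigD1 i)//= ltr_pwDl ?sumr_ge0//.
by case: (posS i) => _; apply.
Qed.

Lemma invmx_block_diag (S : forall i, 'M[R]_#|B i|) : (forall i, S i \in unitmx) ->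
  invmx (block_diag S) = block_diag (fun i => invmx (S i)).
Proof.
move=> uS; have SP : block_diag S *m block_diag (fun i => invmx (S i)) = 1%:M.
  rewrite -block_sel_sum mulmx_suml; apply: eq_bigr => i _.
  rewrite mulmx_sumr (bigD1 i)//= big1 => [|j ji].
    rewrite addr0 !mulmxA -(mulmxA _ (E i) (E i)^T) block_selMid mulmx1.
    by rewrite mulmxK.
  by rewrite !mulmxA -(mulmxA _ (E i) (E j)^T) block_selM 1?eq_sym// mulmx0 !mul0mx.
have [uD _] := mulmx1_unit SP.
by rewrite -[LHS]mulmx1 -SP mulKmx.
Qed.

Lemma posdef_unit m (S : 'M[R]_m) : posdef S -> S \in unitmx.
Proof.
move=> /cholesky_substitution[L [-> L0 _]].
by rewrite unitmx_mul unitmx_tr unitmxE unitfE gt_eqF.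
Qed.

(** A block-diagonal covariance matrix has a block-diagonal inverse, so the
    exponent of the Gaussian is the sum of those of its blocks. *)
Lemma propto_block_gaussian theta : (forall i, posdef (theta i).2) ->
  propto (fun x => \prod_i block_gauss theta i x) (block_gaussian theta).
Proof.
move=> pos; have posC : posdef (block_cov theta) by exact: posdef_block_diag.
pose c (m : nat) (S : 'M[R]_m) := (Num.sqrt ((2 * pi) ^+ m * \det S))^-1.
have c0 m (S : 'M[R]_m) : posdef S -> 0 < c m S.
  move=> pS; have := gauss_pdf_gt0 0 (vec 0 : euclid R m) pS.
  by rewrite /gauss_pdf -/(c m S) pmulr_lgt0// expR_gt0.
exists (\prod_i c _ (theta i).2 / c _ (block_cov theta)).
  by rewrite divr_gt0 ?c0//; apply: prodr_gt0 => i _; exact: c0.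
move=> x; rewrite /block_gaussian /gauss_pdf -/(c _ (block_cov theta)).
rewrite mulrA divfK ?gt_eqF ?c0//.
rewrite /block_gauss /gauss_pdf big_split/=; congr (_ * _).
rewrite -expR_sum; congr expR.
rewrite invmx_block_diag; last by move=> i; exact: posdef_unit.
rewrite -mulr_suml; congr (_ / _).
rewrite block_form summxE -sumrN; apply: eq_bigr => i _; congr (- (_ _ _)).
have -> // : (row_of x - block_mean theta) *m (E i)^T =
  row_of (block (B i) x) - (theta i).1.
rewrite row_of_block mulmxBl /block_mean mulmx_suml (bigD1 i)//= big1.
  by rewrite addr0 -mulmxA block_selMid mulmx1.
by move=> j ji; rewrite -mulmxA block_selM// mulmx0.
Qed.

Lemma measurable_block_gauss theta i : measurable_fun setT (block_gauss theta i).
Proof.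
apply: measurableT_comp; [exact: measurable_gauss_pdf|exact: measurable_block].
Qed.

Lemma block_gauss_gt0 theta i x : posdef (theta i).2 -> 0 < block_gauss theta i x.
Proof. by move=> pS; exact: gauss_pdf_gt0. Qed.

Lemma off_block_block_gauss theta i j : i != j -> off_block (B i) (block_gauss theta j).
Proof.
move=> ij x y xy; congr gauss_pdf; apply: eq_from_tnth => a.
rewrite !tnth_mktuple; apply: xy.
by have /disjointFl -> := B_disjoint ij; rewrite ?enum_valP.
Qed.

End BlockGaussian.

(** * Expectation propagation on a product target *)

Section Propto.
Context {R : realType} {n : nat}.
Implicit Types f g h : euclid R n -> R.

Lemma propto_refl f : propto f f.
Proof. by exists 1 => // x; rewrite mul1r. Qed.

Lemma propto_sym f g : propto f g -> propto g f.
Proof.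
move=> [c c0 fE]; exists c^-1; first by rewrite invr_gt0.
by move=> x; rewrite fE mulKf ?gt_eqF.
Qed.

Lemma propto_trans g f h : propto f g -> propto g h -> propto f h.
Proof.
move=> [c c0 fE] [d d0 gE]; exists (c * d); first by rewrite mulr_gt0.
by move=> x; rewrite fE gE mulrA.
Qed.

Lemma proptoM f f' g g' : propto f f' -> propto g g' ->
  propto (fun x => f x * g x) (fun x => f' x * g' x).
Proof.
move=> [c c0 fE] [d d0 gE]; exists (c * d); first by rewrite mulr_gt0.
by move=> x; rewrite fE gE mulrACA.
Qed.

Lemma proptoV f g : propto f g -> propto (fun x => (f x)^-1) (fun x => (g x)^-1).
Proof.
move=> [c c0 fE]; exists c^-1; first by rewrite invr_gt0.
by move=> x; rewrite fE invfM.
Qed.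

Lemma propto_prod (J : finType) (P : pred J) (F G : J -> euclid R n -> R) :
  (forall j, propto (F j) (G j)) ->
  propto (fun x => \prod_(j | P j) F j x) (fun x => \prod_(j | P j) G j x).
Proof.
move=> FG; elim: (index_enum J) => [|j s IHs].
  by exists 1 => // x; rewrite !big_nil mulr1.
have [Pj|Pj] := boolP (P j).
  have [c c0 E] := proptoM (FG j) IHs; exists c => // x.
  by rewrite !big_cons Pj E.
have [c c0 E] := IHs; exists c => // x.
by rewrite !big_cons (negbTE Pj) E.
Qed.

End Propto.

Section Sweep.
Context {R : realType} {n : nat} {I : finType} (B : I -> {set 'I_n}).
Variable t : forall i : I, euclid R #|B i| -> R.
Hypothesis B_disjoint : forall i j : I, i != j -> [disjoint B i & B j]%bool.
Hypothesis B_cover : forall k : 'I_n, exists i : I, k \in B i.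
Hypothesis t_density : forall i : I, normalizable_moment2 (@t i).
Implicit Types (theta : @block_params R n I B) (T : ep_state R n I).

Let f : ep_state R n I := fun i x => @t i (block (B i) x).

Definition target_params : @block_params R n I B :=
  fun i => (mean (normalized (@t i)), covmx (normalized (@t i))).

Definition update_params theta i : @block_params R n I B :=
  fun j => if j == i then target_params j else theta j.

Definition approximates T theta := forall j, propto (T j) (block_gauss theta j).

Definition posdef_params theta := forall i, posdef (theta i).2.

Lemma posdef_target_params : posdef_params target_params.
Proof. by move=> i; apply/posdef_covmx/density_normalized. Qed.

Lemma posdef_update_params theta i :
  posdef_params theta -> posdef_params (update_params theta i).
Proof.
move=> pos j; rewrite /update_params; case: eqP => _; last exact: pos.
exact: posdef_target_params.
Qed.

Lemma density_block_gaussian theta : posdef_params theta -> density (block_gaussian theta).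
Proof. by move=> pos; apply/density_gauss/posdef_block_diag. Qed.

Lemma block_gauss_update theta i : block_gauss (update_params theta i) i =
  block_gauss target_params i.
Proof.
have E : update_params theta i i = target_params i by rewrite /update_params eqxx.
by apply/funext => x; rewrite /block_gauss E.
Qed.

Lemma block_gauss_updateN theta i j : j != i ->
  block_gauss (update_params theta i) j = block_gauss theta j.
Proof.
move=> ji; have E : update_params theta i j = theta j.
  by rewrite /update_params (negbTE ji).
by apply/funext => x; rewrite /block_gauss E.
Qed.

Lemma prod_update_params theta i x :
  \prod_j block_gauss (update_params theta i) j x =
  block_gauss target_params i x * \prod_(j | j != i) block_gauss theta j x.
Proof.
rewrite (bigD1 i isT) block_gauss_update; congr (_ * _).
by apply: eq_bigr => j ji; rewrite block_gauss_updateN.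
Qed.

(** In the tilted distribution the factor of block [i] is the exact one, so
    that its Gaussian projection is the product Gaussian whose block [i] has
    the moments of the exact factor and whose other blocks are unchanged. *)
Lemma tilted_moments theta i T : posdef_params theta -> approximates T theta ->
  normalizable_moment2 (ep_tilted f T i) /\
  same_moments (normalized (ep_tilted f T i))
               (block_gaussian (update_params theta i)).
Proof.
move=> pos TE; have posU := posdef_update_params i pos.
pose c x := \prod_(j | j != i) block_gauss theta j x.
pose p := normalized (@t i).
pose g := gauss_pdf (target_params i).1 (target_params i).2.
have dp : density p by exact: density_normalized.
have dg : density g by apply: density_gauss; exact: posdef_target_params.
have pg : same_moments p g.
  by have [mg cg] := gauss_moments (target_params i).1 (posdef_target_params i).
have mc : measurable_fun setT c.
  rewrite (_ : c = fun x => \prod_(j <- [seq j <- index_enum I | j != i])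
      block_gauss theta j x); last by apply/funext => x; rewrite big_filter.
  by apply: measurable_prod => j _; exact: measurable_block_gauss.
have c0 x : 0 <= c x by apply: prodr_ge0 => j _; exact/ltW/block_gauss_gt0.
have oc : off_block (B i) c.
  move=> x y xy; apply: eq_bigr => j ji.
  by apply: off_block_block_gauss xy => //; rewrite eq_sym.
have dU := density_block_gaussian posU.
have gcE : propto (fun x => g (block (B i) x) * c x)
    (block_gaussian (update_params theta i)).
  have := propto_block_gaussian B_disjoint B_cover posU; congr propto.
  by apply/funext => x; rewrite prod_update_params.
have [ngc gcN] := normalizable_moment2_propto gcE dU.1.
have [npc mom] := same_moments_block_subst dp dg pg mc c0 oc ngc.
have tE : propto (ep_tilted f T i) (fun x => p (block (B i) x) * c x).
  apply: proptoM; last exact: propto_prod.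
  have [_ _ /andP[Z0 Zoo] _] := t_density i.
  exists (\int[lebesgue_euclid R #|B i|]_y @t i y).
    by rewrite fine_gt0// Z0.
  move=> x; rewrite /p /normalized mulrC divfK// gt_eqF// fine_gt0//.
  by rewrite Z0.
have [nt tN] := normalizable_moment2_propto tE npc.
split => //; rewrite tN; move: mom.
by rewrite gcN (normalized_density dU).
Qed.

(** Dividing the projection by the cavity leaves the Gaussian of block [i]
    alone, whatever the other approximations are. *)
Lemma ep_updateP theta i T T' : posdef_params theta -> approximates T theta ->
  ep_update f i T T' <-> approximates T' (update_params theta i).
Proof.
move=> pos TE; have posU := posdef_update_params i pos.
have [nt [me ce]] := tilted_moments i pos TE.
have dt := density_normalized nt.
have posC : posdef (block_cov (update_params theta i)) by exact: posdef_block_diag.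
have [mb cb] := gauss_moments (block_mean (update_params theta i)) posC.
have projE q : gaussian_projection (normalized (ep_tilted f T i)) q <->
    q = block_gaussian (update_params theta i).
  by rewrite gaussian_projectionP// me ce mb cb.
have newE j : propto
    (if j == i then fun x => block_gaussian (update_params theta i) x / ep_cavity T i x
     else T j)
    (block_gauss (update_params theta i) j).
  have [->|ji] := eqVneq j i; last first.
    by rewrite block_gauss_updateN.
  pose c x := \prod_(j | j != i) block_gauss theta j x.
  have c0 x : c x != 0.
    by rewrite gt_eqF//; apply: prodr_gt0 => k _; exact: block_gauss_gt0.
  have gE : propto (block_gaussian (update_params theta i))
      (fun x => block_gauss (update_params theta i) i x * c x).
    apply: propto_sym; have := propto_block_gaussian B_disjoint B_cover posU.
    congr propto; apply/funext => x.
    by rewrite prod_update_params block_gauss_update.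
  have cE : propto (ep_cavity T i) c by exact: propto_prod.
  have := proptoM gE (proptoV cE); congr propto.
  by apply/funext => x; rewrite mulfK.
split.
  move=> [_ [q /projE -> T'E]] j; exact: propto_trans (T'E j) (newE j).
move=> T'E; split => //; exists (block_gaussian (update_params theta i)).
  exact/projE.
by move=> j; apply: propto_trans (T'E j) _; exact/propto_sym/newE.
Qed.

Lemma update_target_params i : update_params target_params i = target_params.
Proof.
by apply: functional_extensionality_dep => j; rewrite /update_params; case: eqP.
Qed.

Lemma moment_matching_target T : approximates T target_params ->
  forall i, moment_matching f T i.
Proof.
move=> TE i; have pos := posdef_target_params.
have [nt mom] := tilted_moments i pos TE.
have gE : propto (ep_global T) (block_gaussian target_params).
  apply: propto_trans (propto_block_gaussian B_disjoint B_cover pos).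
  exact: propto_prod.
have db := density_block_gaussian pos.
have [ng gN] := normalizable_moment2_propto gE db.1.
rewrite update_target_params in mom; case: mom => me ce.
by split; [exact: ng|exact: nt|rewrite gN (normalized_density db); split].
Qed.

Variable order : nat -> seq I.
Hypothesis order_sweep : forall r : nat, perm_eq (order r) (enum I).
Variable theta0 : @block_params R n I B.
Hypothesis theta0_posdef : posdef_params theta0.

(** The parameters after [k] updates: a block carries its final ones as soon
    as the first sweep has visited it. *)
Definition run_params (k : nat) : @block_params R n I B :=
  fun j => if (index j (order 0) < k)%N then target_params j else theta0 j.

Lemma posdef_run_params k : posdef_params (run_params k).
Proof.
move=> j; rewrite /run_params; case: ifP => _; last exact: theta0_posdef.
exact: posdef_target_params.
Qed.

Lemma index_order j r : (index j (order r) < #|I|)%N.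
Proof.
rewrite cardE -(perm_size (order_sweep r)) index_mem.
by rewrite (perm_mem (order_sweep r)) mem_enum.
Qed.

Lemma run_params_sweep k : (#|I| <= k)%N -> run_params k = target_params.
Proof.
move=> Ik; apply: functional_extensionality_dep => j.
by rewrite /run_params (leq_trans (index_order j 0) Ik).
Qed.

Lemma run_paramsS k i : onth (order (k %/ #|I|)%N) (k %% #|I|)%N = Some i ->
  run_params k.+1 = update_params (run_params k) i.
Proof.
move=> oi; apply: functional_extensionality_dep => j.
have I0 : (0 < #|I|)%N by apply/card_gt0P; exists i.
have [Ik|kI] := leqP #|I| k.
  by rewrite !run_params_sweep ?(leq_trans Ik)// update_target_params.
move: oi; rewrite divn_small// modn_small// => oi.
have size_order : size (order 0) = #|I| by rewrite (perm_size (order_sweep 0)) -cardE.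
have iE : nth i (order 0) k = i by exact: onth_nth oi.
have uo : uniq (order 0) by rewrite (perm_uniq (order_sweep 0)) enum_uniq.
have idx : index i (order 0) = k by rewrite -[X in index X _]iE index_uniq// size_order.
rewrite /update_params /run_params ltnS leq_eqVlt.
have [->|ji] := eqVneq j i; first by rewrite idx eqxx.
suff /negbTE -> : index j (order 0) != k by [].
apply: contra_neq ji => jk.
by rewrite -[RHS]iE -jk nth_index// -index_mem size_order index_order.
Qed.

Lemma approximates_ep_run (T0 : ep_state R n I) (st : nat -> ep_state R n I) :
  approximates T0 theta0 -> ep_run f order T0 st ->
  forall k, approximates (st k) (run_params k).
Proof.
move=> T0E [st0 stS]; elim=> [j|k IHk j]; first exact: propto_trans (st0 j) (T0E j).
have I0 : (0 < #|I|)%N by apply/card_gt0P; exists j.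
have [i oi] : exists i, onth (order (k %/ #|I|)%N) (k %% #|I|)%N = Some i.
  have : onth (order (k %/ #|I|)%N) (k %% #|I|)%N.
    by rewrite onthTE (perm_size (order_sweep _)) -cardE ltn_mod.
  by case: onth => // i _; exists i.
have /(ep_updateP i _ (posdef_run_params k) IHk) := stS _ _ oi.
by rewrite -(run_paramsS oi); exact.
Qed.

Lemma ep_run_block_gauss (T0 : ep_state R n I) : approximates T0 theta0 ->
  ep_run f order T0 (fun k => block_gauss (run_params k)).
Proof.
move=> T0E; split => [i|k i oi]; first exact/propto_sym/T0E.
apply/(ep_updateP i _ (posdef_run_params k)) => [j|]; first exact: propto_refl.
by rewrite -(run_paramsS oi) => j; exact: propto_refl.
Qed.

Lemma ep_run_converges (T0 : ep_state R n I) (st : nat -> ep_state R n I) :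
  approximates T0 theta0 -> ep_run f order T0 st ->
  (forall k i, (#|I| <= k)%N -> propto (st k i) (st #|I| i)) /\
  (forall i, moment_matching f (st #|I|) i).
Proof.
move=> T0E run; have stE := approximates_ep_run T0E run.
have stT k : (#|I| <= k)%N -> approximates (st k) target_params.
  by move=> Ik; rewrite -(run_params_sweep Ik).
split; last exact/moment_matching_target/stT.
move=> k i Ik; apply: propto_trans (stT _ Ik i) _.
by apply/propto_sym; exact: (stT _ (leqnn _)).
Qed.

End Sweep.

Lemma block_params_of_gaussian (R : realType) (n : nat) (I : finType)
    (B : I -> {set 'I_n}) (t0 : forall i : I, euclid R #|B i| -> R) :
  (forall i : I, exists2 p, is_gaussian p & propto (t0 i) p) ->
  exists2 theta0 : @block_params R n I B, posdef_params theta0 &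
    approximates (fun i x => t0 i (block (B i) x)) theta0.
Proof.
move=> gt0; have ex i : exists mS : 'rV[R]_#|B i| * 'M[R]_#|B i|,
    posdef mS.2 /\ propto (t0 i) (gauss_pdf mS.1 mS.2).
  by have [p [m [S [pS /funext ->]]] tp] := gt0 i; exists (m, S).
exists (fun i => projT1 (cid (ex i))) => i.
  by have [] := projT2 (cid (ex i)).
have [_ [c c0 cE]] := projT2 (cid (ex i)).
by exists c => // x; exact: cE.
Qed.

Local Close Scope ring_scope.
Local Close Scope classical_set_scope.

Theorem proposition2p2 (R : realType) (n : nat) (I : finType)
    (B : I -> {set 'I_n})
    (t t0 : forall i : I, euclid R #|B i| -> R)
    (order : nat -> seq I)
    (B_disjoint : forall i j : I, i != j -> [disjoint B i & B j])
    (B_cover : forall k : 'I_n, exists i : I, k \in B i)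
    (t_density : forall i : I, normalizable_moment2 (t i))
    (t0_gaussian : forall i : I, exists2 p, is_gaussian p & propto (t0 i) p)
    (order_sweep : forall r : nat, perm_eq (order r) (enum I)) :
  let f : ep_state R n I := fun i x => t i (block (B i) x) in
  let T0 : ep_state R n I := fun i x => t0 i (block (B i) x) in
  (exists st, ep_run f order T0 st) /\
  (forall st, ep_run f order T0 st ->
     (forall (k : nat) (i : I), (#|I| <= k)%N -> propto (st k i) (st #|I| i)) /\
     (forall i : I, moment_matching f (st #|I|) i)).
Proof.
move=> f T0; have [theta0 pos0 T0E] := block_params_of_gaussian t0_gaussian.
split.
  exists (fun k => block_gauss (run_params t order theta0 k)).
  exact: (ep_run_block_gauss B_disjoint B_cover t_density order_sweep pos0 T0E).
move=> st run.
exact: (ep_run_converges B_disjoint B_cover t_density order_sweep pos0 T0E run).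
Qed.
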